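(* Let $R$ be a commutative Noetherian ring. Then $$\mathrm{ann}_R\mathsf D_{\mathsf{sg}}(R)=\mathrm{ca}_R(\mathrm{mod}(R)),$$ where $\mathrm{ca}_R(\mathrm{mod}(R))=\bigcap_{M\in\mathrm{mod}(R)}\mathrm{ca}_R(M)$.
   Context: $\mathrm{mod}(R)$ is the category of finitely generated $R$-modules. For $M\in\mathrm{mod}(R)$ and $n\ge0$, $\mathrm{ca}^n_R(M)=\{r\in R\mid r\,\mathrm{Ext}^i_R(M,N)=0\text{ for all }i\ge n,\ N\in\mathrm{mod}(R)\}$ and $\mathrm{ca}_R(M)=\bigcup_{n\ge0}\mathrm{ca}^n_R(M)$. $\mathsf D^f(R)$ is the full subcategory of the derived category $\mathsf D(R)$ of $R$-modules formed by complexes whose total cohomology $\bigoplus_iH^i(X)$ is finitely generated, and $\mathsf D_{\mathsf{sg}}(R)=\mathsf D^f(R)/\mathrm{thick}_{\mathsf D(R)}(R)$ is the Verdier quotient by the perfect complexes. $\mathrm{ann}_R\mathsf D_{\mathsf{sg}}(R)=\bigcap_{X\in\mathsf D_{\mathsf{sg}}(R)}\{r\in R\mid r\cdot\mathrm{Hom}_{\mathsf D_{\mathsf{sg}}(R)}(X,X)=0\}$. *)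

(* Defs.v *)
From HB Require Import structures.
From mathcomp Require Import all_boot all_algebra.
From mathcomp Require Import boolp classical_sets functions.

Set Implicit Arguments.
Unset Strict Implicit.
Unset Printing Implicit Defensive.

Import GRing.Theory.
Local Open Scope ring_scope.
Local Open Scope classical_set_scope.
Local Open Scope quotient_scope.

Definition ideal (R : comPzRingType) (I : set R) : Prop :=
  [/\ I 0, (forall x y, I x -> I y -> I (x + y))
    & (forall r x, I x -> I (r * x))].

Definition noetherian (R : comPzRingType) : Prop :=
  forall I : set R, ideal I ->
    exists (n : nat) (g : 'I_n -> R),
      I = [set x | exists c : 'I_n -> R, x = \sum_(k < n) c k * g k].

Definition fin_gen (R : comPzRingType) (M : lmodType R) : Prop :=
  exists (n : nat) (g : 'I_n -> M),
    forall x, exists c : 'I_n -> R, x = \sum_(k < n) c k *: g k.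

Definition projective (R : comPzRingType) (P : lmodType R) : Prop :=
  forall (U V : lmodType R) (p : {linear U -> V}) (f : {linear P -> V}),
    (forall v, exists u, p u = v) ->
    exists h : {linear P -> U}, forall x, p (h x) = f x.

Section LinearMaps.
Variables (R : comPzRingType) (U V : lmodType R).

Definition Hom : Type := {linear U -> V}.
Implicit Types f g h : Hom.

HB.instance Definition _ := gen_eqMixin Hom.
HB.instance Definition _ := gen_choiceMixin Hom.

Definition Hom_fun f : {linear U -> V} := f.

Lemma HomP f g : (forall x, Hom_fun f x = Hom_fun g x) -> f = g.
Proof.
rewrite /Hom_fun; case: f g => [f [[fa] [fs]]] [g [[ga] [gs]]] /= /funext fg.
by subst g; rewrite (Prop_irrelevance fa ga) (Prop_irrelevance fs gs).
Qed.

Definition Hom0 : Hom := \0 : {linear U -> V}.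
Definition HomD f g : Hom := Hom_fun f \+ Hom_fun g : {linear U -> V}.
Definition HomN f : Hom := \- Hom_fun f : {linear U -> V}.
Definition HomZ (r : R) f : Hom := r \*: Hom_fun f : {linear U -> V}.

Let HomDA : associative HomD.
Proof. by move=> f g h; apply: HomP => x; exact: addrA. Qed.
Let HomDC : commutative HomD.
Proof. by move=> f g; apply: HomP => x; exact: addrC. Qed.
Let Hom0D : left_id Hom0 HomD.
Proof. by move=> f; apply: HomP => x; exact: add0r. Qed.
Let HomND : left_inverse Hom0 HomN HomD.
Proof. by move=> f; apply: HomP => x; exact: addNr. Qed.

HB.instance Definition _ := GRing.isZmodule.Build Hom HomDA HomDC Hom0D HomND.

Let HomZA (r s : R) f : HomZ r (HomZ s f) = HomZ (r * s) f.
Proof. by apply: HomP => x; exact: scalerA. Qed.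
Let Hom1Z : left_id 1 HomZ.
Proof. by move=> f; apply: HomP => x; exact: scale1r. Qed.
Let HomZDr : right_distributive HomZ +%R.
Proof. by move=> r f g; apply: HomP => x; exact: scalerDr. Qed.
Let HomZDl f : {morph HomZ^~ f : r s / r + s}.
Proof. by move=> r s; apply: HomP => x; exact: scalerDl. Qed.

HB.instance Definition _ :=
  GRing.Zmodule_isLmodule.Build R Hom HomZA Hom1Z HomZDr HomZDl.

End LinearMaps.

Section Precomposition.
Variables (R : comPzRingType) (U V W : lmodType R) (f : {linear U -> V}).

Definition precomp (g : Hom V W) : Hom U W := Hom_fun g \o f : {linear U -> W}.

Let precomp_linear : linear precomp.
Proof. by move=> r g h; apply: HomP. Qed.

HB.instance Definition _ :=
  GRing.isLinear.Build R (Hom V W) (Hom U W) *:%R precomp precomp_linear.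

End Precomposition.

(* For U -f-> V -g-> W, the module ker g / (im f `&` ker g); in every use below *)
(* g \o f = 0, so that this is the homology ker g / im f at V.                  *)
Section Homology.
Variables (R : comPzRingType) (U V W : lmodType R).
Variables (f : {linear U -> V}) (g : {linear V -> W}).

Definition cycle_pred : pred V := fun v => g v == 0.

Let cycle_subproof : subsemimod_closed cycle_pred.
Proof.
split; first split; rewrite /cycle_pred.
- by rewrite unfold_in linear0.
- by move=> x y; rewrite !unfold_in linearD => /eqP-> /eqP->; rewrite addr0.
- by move=> r x; rewrite !unfold_in linearZ_LR => /eqP->; rewrite scaler0.
Qed.

HB.instance Definition _ :=
  GRing.isSubmodClosed.Build R V cycle_pred cycle_subproof.

Record cycles : Type := Cycle { cycle_val :> V; cycleP : cycle_pred cycle_val }.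

HB.instance Definition _ := [isSub for cycle_val].
HB.instance Definition _ := [Choice of cycles by <:].
HB.instance Definition _ := [SubChoice_isSubLmodule of cycles by <:].

Definition boundary_pred : pred cycles := fun v => `[< exists u, f u = val v >].

Let boundary_subproof : subsemimod_closed boundary_pred.
Proof.
split; first split; rewrite /boundary_pred.
- by rewrite unfold_in; apply/asboolP; exists 0; rewrite linear0 raddf0.
- move=> x y; rewrite !unfold_in => /asboolP[u fu] /asboolP[v fv].
  by apply/asboolP; exists (u + v); rewrite linearD fu fv raddfD.
- move=> r x; rewrite !unfold_in => /asboolP[u fu].
  by apply/asboolP; exists (r *: u); rewrite linearZ fu linearZ.
Qed.

HB.instance Definition _ :=
  GRing.isSubmodClosed.Build R cycles boundary_pred boundary_subproof.

Definition boundaries : zmodClosed cycles :=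
  GRing.ZmodClosed.clone cycles boundary_pred _.

Definition homology : Type := Quotient.quot boundaries.

HB.instance Definition _ := GRing.Zmodule.on homology.

Definition homology_class (v : cycles) : homology :=
  \pi_(Quotient.quot boundaries) v.

Definition homology_repr (c : homology) : cycles :=
  repr (c : Quotient.quot boundaries).

Definition homology_scale (r : R) (c : homology) : homology :=
  homology_class (r *: homology_repr c).

Let eq_homology_class (v w : cycles) :
  (homology_class v == homology_class w) = (v - w \in boundaries).
Proof. by rewrite Quotient.idealrBE. Qed.

Let homology_reprK c : homology_class (homology_repr c) = c.
Proof. exact: reprK. Qed.

Let homology_classD v w :
  homology_class (v + w) = homology_class v + homology_class w.
Proof. exact: Quotient.pi_add. Qed.

Let homology_classZ r v :
  homology_class (r *: v) = homology_scale r (homology_class v).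
Proof.
apply/eqP; rewrite eq_homology_class -scalerBr rpredZ //.
by rewrite -eq_homology_class homology_reprK.
Qed.

Let homology_scaleA r s c :
  homology_scale r (homology_scale s c) = homology_scale (r * s) c.
Proof. by rewrite -[c]homology_reprK -!homology_classZ scalerA. Qed.

Let homology_scale1 : left_id 1 homology_scale.
Proof. by move=> c; rewrite -[c]homology_reprK -homology_classZ scale1r. Qed.

Let homology_scaleDr : right_distributive homology_scale +%R.
Proof.
move=> r c d; rewrite -[c]homology_reprK -[d]homology_reprK.
by rewrite -homology_classD -!homology_classZ -homology_classD scalerDr.
Qed.

Let homology_scaleDl c : {morph homology_scale^~ c : r s / r + s}.
Proof.
move=> r s; rewrite -[c]homology_reprK -!homology_classZ.
by rewrite -homology_classD scalerDl.
Qed.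

HB.instance Definition _ := GRing.Zmodule_isLmodule.Build R homology
  homology_scaleA homology_scale1 homology_scaleDr homology_scaleDl.

End Homology.

Definition homology_map (R : comPzRingType) (U V W U' V' W' : lmodType R)
    (f : {linear U -> V}) (g : {linear V -> W})
    (f' : {linear U' -> V'}) (g' : {linear V' -> W'}) (a : {linear V -> V'})
    (ga : forall v, cycle_pred g v -> cycle_pred g' (a v))
    (c : homology f g) : homology f' g' :=
  let z := homology_repr c in homology_class f' (Cycle (ga z (cycleP z))).

Record resolution (R : comPzRingType) (M : lmodType R) := Resolution {
  res_mod :> nat -> lmodType R;
  res_diff : forall n, {linear res_mod n.+1 -> res_mod n};
  res_aug : {linear res_mod 0%N -> M};
  res_projective : forall n, projective (res_mod n);
  res_aug_surj : forall m, exists x, res_aug x = m;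
  res_exact0 : forall x, res_aug x = 0 <-> exists y, res_diff 0%N y = x;
  res_exact : forall n x,
    res_diff n x = 0 <-> exists y, res_diff n.+1 y = x }.

Section Ext.
Variables (R : comPzRingType) (M : lmodType R) (P : resolution M).
Variable N : lmodType R.

(* The differential of Hom(P, N) with target Hom(P_n, N). *)
Definition ext_diff (n : nat) : {linear Hom (P n.-1) N -> Hom (P n) N} :=
  match n return {linear Hom (P n.-1) N -> Hom (P n) N} with
  | 0 => \0
  | k.+1 => precomp (res_diff P k)
  end.

Definition Ext (n : nat) : lmodType R :=
  homology (ext_diff n) (ext_diff n.+1).

End Ext.

(* Ext does not depend, up to isomorphism of R-modules, on the projective     *)
(* resolution of M it is computed from, and every M has one.                  *)
Definition ca_at (R : comPzRingType) (n : nat) (M : lmodType R) : set R :=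
  [set r | forall (P : resolution M) (N : lmodType R), fin_gen N ->
    forall i, (n <= i)%N -> forall x : Ext P N i, r *: x = 0].

Definition ca (R : comPzRingType) (M : lmodType R) : set R :=
  \bigcup_n ca_at n M.

Definition ca_mod (R : comPzRingType) : set R :=
  [set r | forall M : lmodType R, fin_gen M -> ca M r].

Arguments ca_mod R : clear implicits.

(* Equality of morphisms is the relation eqm, so that localizations need no   *)
(* quotient types.                                                            *)
Record category := Category {
  ob :> Type;
  hom : ob -> ob -> Type;
  eqm : forall X Y, hom X Y -> hom X Y -> Prop;
  idm : forall X, hom X X;
  comp : forall X Y Z, hom Y Z -> hom X Y -> hom X Z;
  eqm_refl : forall X Y (f : hom X Y), eqm f f;
  eqm_sym : forall X Y (f g : hom X Y), eqm f g -> eqm g f;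
  eqm_trans : forall X Y (f g h : hom X Y), eqm f g -> eqm g h -> eqm f h;
  eqm_comp : forall X Y Z (g g' : hom Y Z) (f f' : hom X Y),
    eqm g g' -> eqm f f' -> eqm (comp g f) (comp g' f');
  compA : forall X Y Z T (h : hom Z T) (g : hom Y Z) (f : hom X Y),
    eqm (comp h (comp g f)) (comp (comp h g) f);
  comp1m : forall X Y (f : hom X Y), eqm (comp (idm Y) f) f;
  compm1 : forall X Y (f : hom X Y), eqm (comp f (idm X)) f }.

Arguments hom {c} X Y.
Arguments eqm {c X Y} f g.
Arguments idm {c} X.
Arguments comp {c X Y Z} g f.

Definition inverse (C : category) (X Y : C) (f : hom X Y) (g : hom Y X) :=
  eqm (comp g f) (idm X) /\ eqm (comp f g) (idm Y).

Definition is_iso (C : category) (X Y : C) (f : hom X Y) : Prop :=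
  exists g, inverse f g.

Definition isomorphic (C : category) (X Y : C) : Prop :=
  exists f : hom X Y, is_iso f.

Section FullSubcategory.
Variables (C : category) (P : C -> Prop).

Definition full_subcategory : category :=
  @Category {X : C | P X} (fun X Y => hom (sval X) (sval Y))
    (fun _ _ => eqm) (fun X => idm (sval X)) (fun _ _ _ => comp)
    (fun _ _ => @eqm_refl C _ _) (fun _ _ => @eqm_sym C _ _)
    (fun _ _ => @eqm_trans C _ _) (fun _ _ _ => @eqm_comp C _ _ _)
    (fun _ _ _ _ => @compA C _ _ _ _) (fun _ _ => @comp1m C _ _)
    (fun _ _ => @compm1 C _ _).

End FullSubcategory.

(* Gabriel-Zisman localization: the category obtained from C by freely adding *)
(* inverses of the morphisms in W.                                            *)
Section Localization.
Variables (C : category) (W : forall X Y : C, hom X Y -> Prop).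

Inductive loc_hom : C -> C -> Type :=
| loc_of X Y (f : hom X Y) : loc_hom X Y
| loc_inv X Y (s : hom X Y) (Ws : W s) : loc_hom Y X
| loc_comp X Y Z (g : loc_hom Y Z) (f : loc_hom X Y) : loc_hom X Z.

Inductive loc_eqm : forall X Y, loc_hom X Y -> loc_hom X Y -> Prop :=
| loc_refl X Y (f : loc_hom X Y) : loc_eqm f f
| loc_sym X Y (f g : loc_hom X Y) : loc_eqm f g -> loc_eqm g f
| loc_trans X Y (f g h : loc_hom X Y) :
    loc_eqm f g -> loc_eqm g h -> loc_eqm f h
| loc_cong X Y Z (g g' : loc_hom Y Z) (f f' : loc_hom X Y) :
    loc_eqm g g' -> loc_eqm f f' -> loc_eqm (loc_comp g f) (loc_comp g' f')
| loc_compA X Y Z T (h : loc_hom Z T) (g : loc_hom Y Z) (f : loc_hom X Y) :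
    loc_eqm (loc_comp h (loc_comp g f)) (loc_comp (loc_comp h g) f)
| loc_comp1m X Y (f : loc_hom X Y) : loc_eqm (loc_comp (loc_of (idm Y)) f) f
| loc_compm1 X Y (f : loc_hom X Y) : loc_eqm (loc_comp f (loc_of (idm X))) f
| loc_of_eqm X Y (f g : hom X Y) : eqm f g -> loc_eqm (loc_of f) (loc_of g)
| loc_of_comp X Y Z (g : hom Y Z) (f : hom X Y) :
    loc_eqm (loc_of (comp g f)) (loc_comp (loc_of g) (loc_of f))
| loc_invl X Y (s : hom X Y) (Ws : W s) :
    loc_eqm (loc_comp (loc_inv Ws) (loc_of s)) (loc_of (idm X))
| loc_invr X Y (s : hom X Y) (Ws : W s) :
    loc_eqm (loc_comp (loc_of s) (loc_inv Ws)) (loc_of (idm Y)).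

Definition localization : category :=
  @Category C loc_hom loc_eqm (fun X => loc_of (idm X)) loc_comp
    loc_refl loc_sym loc_trans loc_cong loc_compA loc_comp1m loc_compm1.

End Localization.

Arguments loc_of {C W X Y} f.

(* Cohomological grading.  The differential is given for every pair of degrees and *)
(* vanishes unless the target degree is the successor of the source degree.    *)

Record complex (R : comPzRingType) := Complex {
  cpx_mod :> int -> lmodType R;
  cpx_diff : forall i j, {linear cpx_mod i -> cpx_mod j};
  cpx_shape : forall i j x, i + 1 != j -> cpx_diff i j x = 0;
  cpx_sq : forall i j k x, cpx_diff j k (cpx_diff i j x) = 0 }.

Definition cohomology (R : comPzRingType) (X : complex R) (i : int) :
    lmodType R :=
  homology (cpx_diff X (i - 1) i) (cpx_diff X i (i + 1)).

(* The direct sum of the H^i(X), i.e. the module of finitely supported        *)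
(* families of classes, is finitely generated.                                *)
Definition total_cohomology_fin_gen (R : comPzRingType) (X : complex R) :=
  let finsupp (x : forall i, cohomology X i) :=
    exists s : seq int, forall i, i \notin s -> x i = 0 in
  exists (n : nat) (g : 'I_n -> forall i, cohomology X i),
    (forall k, finsupp (g k)) /\
    forall x, finsupp x -> exists c : 'I_n -> R,
      forall i, x i = \sum_(k < n) c k *: g k i.

Record chain_map (R : comPzRingType) (X Y : complex R) := ChainMap {
  cm_fun :> forall i, {linear X i -> Y i};
  cm_comm : forall i j x,
    cm_fun j (cpx_diff X i j x) = cpx_diff Y i j (cm_fun i x) }.

Section Complexes.
Variable R : comPzRingType.
Implicit Types X Y Z : complex R.

Definition cm_id X : chain_map X X :=
  @ChainMap R X X (fun i => idfun) (fun i j x => erefl).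

Definition cm_zero X Y : chain_map X Y.
Proof. by exists (fun i => \0) => i j x /=; rewrite linear0. Defined.

Definition cm_scale (r : R) X : chain_map X X.
Proof. by exists (fun i => r \*: idfun) => i j x /=; rewrite linearZ. Defined.

Definition cm_comp X Y Z (g : chain_map Y Z) (f : chain_map X Y) :
  chain_map X Z.
Proof. by exists (fun i => g i \o f i) => i j x /=; rewrite !cm_comm. Defined.

Definition complexes : category.
Proof.
refine (@Category (complex R) (@chain_map R)
  (fun X Y f g => forall i x, f i x = g i x) cm_id cm_comp _ _ _ _ _ _ _) => //.
- by move=> X Y f g h fg gh i x; rewrite fg gh.
- by move=> X Y Z g g' f f' gg' ff' i x /=; rewrite ff' gg'.
Defined.

Lemma cm_cycle X Y (f : chain_map X Y) i v :
  cycle_pred (cpx_diff X i (i + 1)) v ->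
  cycle_pred (cpx_diff Y i (i + 1)) (f i v).
Proof. by rewrite /cycle_pred -cm_comm => /eqP->; rewrite linear0. Qed.

Definition cohomology_map X Y (f : chain_map X Y) i :
    cohomology X i -> cohomology Y i :=
  homology_map (cpx_diff Y (i - 1) i) (@cm_cycle X Y f i).

Definition quasi_iso X Y (f : chain_map X Y) : Prop :=
  forall i, bijective (cohomology_map f (i := i)).

Definition stalk_mod (M : lmodType R) (i : int) : lmodType R :=
  if i == 0 then M else 'rV[R]_0.

Definition stalk (M : lmodType R) : complex R :=
  @Complex R (stalk_mod M) (fun i j => \0)
    (fun i j x _ => erefl) (fun i j k x => erefl).

Definition zero_complex : complex R :=
  @Complex R (fun _ => 'rV[R]_0) (fun i j => \0)
    (fun i j x _ => erefl) (fun i j k x => erefl).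

Section DirectSum.
Variables X Y : complex R.

Definition sum_mod (i : int) : lmodType R := (X i * Y i)%type.

Definition sum_diff i j (z : sum_mod i) : sum_mod j :=
  (cpx_diff X i j z.1, cpx_diff Y i j z.2).

Let sum_diff_linear i j : linear (@sum_diff i j).
Proof. by move=> r x y; rewrite /sum_diff !linearP. Qed.

HB.instance Definition _ i j :=
  GRing.isLinear.Build R (sum_mod i) (sum_mod j) *:%R (@sum_diff i j)
    (@sum_diff_linear i j).

Definition direct_sum : complex R.
Proof.
exists sum_mod (fun i j => @sum_diff i j).
- by move=> i j x ij; rewrite /= /sum_diff !cpx_shape.
- by move=> i j k x; rewrite /= /sum_diff !cpx_sq.
Defined.

End DirectSum.

Definition shift (n : int) X : complex R.
Proof.
exists (fun i => X (i + n))
  (fun i j => (-1) ^+ `|n|%N \*: cpx_diff X (i + n) (j + n)).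
- move=> i j x ij; rewrite /= cpx_shape ?scaler0 //.
  by rewrite addrAC (inj_eq (addIr n)).
- by move=> i j k x; rewrite /= linearZ /= cpx_sq !scaler0.
Defined.

(* The identity of X_i when i = j, and 0 otherwise. *)
Definition degree_cast X (i j : int) : X i -> X j :=
  match @eqP _ i j with
  | ReflectT e => fun x => ecast k (X k) e x
  | ReflectF _ => fun=> 0
  end.

Let degree_cast_linear X i j : linear (@degree_cast X i j).
Proof.
rewrite /degree_cast => r x y; case: eqP => [e|_]; last by rewrite scaler0 addr0.
by case: _ / e.
Qed.

HB.instance Definition _ X i j :=
  GRing.isLinear.Build R (X i) (X j) *:%R (@degree_cast X i j)
    (@degree_cast_linear X i j).

(* The mapping cone: cone(u)^i = Y^i (+) X^{i+1}, d(y, x) = (dy + ux, -dx). *)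
Section Cone.
Variables (X Y : complex R) (u : chain_map X Y).

Definition cone_mod (i : int) : lmodType R := (Y i * X (i + 1)%R)%type.

Definition cone_diff i j (z : cone_mod i) : cone_mod j :=
  (cpx_diff Y i j z.1 + u j (degree_cast j z.2),
   - cpx_diff X (i + 1) (j + 1) z.2).

Let cone_diff_linear i j : linear (@cone_diff i j).
Proof.
move=> r x y; rewrite /cone_diff /= (linearP (@degree_cast X _ _)) !linearP /=.
by rewrite addrACA -scalerDr.
Qed.

HB.instance Definition _ i j :=
  GRing.isLinear.Build R (cone_mod i) (cone_mod j) *:%R (@cone_diff i j)
    (@cone_diff_linear i j).

Let degree_castE i j (x : X i) : i != j -> degree_cast j x = 0.
Proof. by rewrite /degree_cast; case: eqP. Qed.

Let degree_castK i (x : X i) : degree_cast i x = x.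
Proof. by rewrite /degree_cast; case: eqP => // e; rewrite eq_axiomK. Qed.

Definition cone : complex R.
Proof.
exists cone_mod (fun i j => @cone_diff i j).
- move=> i j [y x] ij; rewrite /= /cone_diff /= degree_castE //.
  by rewrite !cpx_shape ?linear0 ?addr0 ?oppr0 // (inj_eq (addIr 1)).
- move=> i j k [y x]; rewrite /= /cone_diff /= linearD /= !cpx_sq add0r.
  rewrite !linearN /= cpx_sq !oppr0; congr (_, _).
  have [jk|jk] := eqVneq (j + 1) k; last first.
    by rewrite cpx_shape // degree_castE // linear0 subr0.
  subst k; rewrite degree_castK.
  have [ij|ij] := eqVneq (i + 1) j.
    by subst j; rewrite degree_castK -cm_comm subrr.
  rewrite degree_castE // !linear0 add0r cpx_shape ?linear0 ?oppr0 //.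
  by rewrite (inj_eq (addIr 1)).
Defined.

End Cone.

End Complexes.

Definition D (R : comPzRingType) : category :=
  localization (C := complexes R) (@quasi_iso R).

Section Singularity.
Variable R : comPzRingType.

Definition in_D (X Y : complex R) (f : chain_map X Y) : @hom (D R) X Y :=
  @loc_of (complexes R) _ X Y f.

(* Z completes s to a distinguished triangle X -s-> Y -> Z -> X[1], i.e. a    *)
(* triangle isomorphic in D(R) to A -u-> B -> cone(u) -> A[1] for some chain  *)
(* map u.  The last two maps of the triangle need not be recorded, as they    *)
(* can be transported along any isomorphism between Z and cone(u).            *)
Definition is_cone (X Y : D R) (s : hom X Y) (Z : D R) : Prop :=
  exists (A B : complex R) (u : chain_map A B)
         (a : @hom (D R) A X) (b : @hom (D R) B Y),
    [/\ is_iso a, is_iso b, eqm (comp s a) (comp b (in_D u))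
      & @isomorphic (D R) (cone u) Z].

(* Full triangulated subcategories closed under isomorphisms and direct       *)
(* summands, given by their objects.                                          *)
Record is_thick (T : D R -> Prop) : Prop := IsThick {
  thick_iso : forall X Y : D R, isomorphic X Y -> T X -> T Y;
  thick_zero : T (zero_complex R);
  thick_shift : forall n X, T X -> T (shift n X);
  thick_cone : forall (X Y : D R) (s : hom X Y) Z,
    is_cone s Z -> T X -> T Y -> T Z;
  thick_summand : forall X Y, T (direct_sum X Y) -> T X }.

(* thick_{D(R)}(R) *)
Definition perfect (X : D R) : Prop :=
  forall T, is_thick T -> T (stalk (R^o : lmodType R)) -> T X.

Definition Df : category :=
  full_subcategory (C := D R) (@total_cohomology_fin_gen R).

(* The Verdier quotient D^f(R) / thick(R): the localization of D^f(R) at the  *)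
(* morphisms with a cone in thick(R).                                         *)
Definition perfect_cone (X Y : Df) (s : hom X Y) : Prop :=
  exists2 Z, @is_cone (sval X) (sval Y) s Z & perfect Z.

Definition Dsg : category := localization (C := Df) perfect_cone.

Definition in_Dsg (X Y : Dsg) (f : chain_map (sval X) (sval Y)) : hom X Y :=
  @loc_of Df _ X Y (in_D f).

(* The R-linear structure on the morphisms of Dsg is the one for which the    *)
(* functor from complexes is R-linear; hence its zero morphisms are the images*)
(* of the zero chain maps, and r f = (r id) f.                                *)
Definition Dsg_zero (X Y : Dsg) : hom X Y := in_Dsg (cm_zero (sval X) (sval Y)).

Definition Dsg_scale (r : R) (X Y : Dsg) (f : hom X Y) : hom X Y :=
  comp (@in_Dsg Y Y (cm_scale r (sval Y))) f.

Definition ann_Dsg : set R :=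
  [set r | forall (X : Dsg) (f : hom X X), eqm (Dsg_scale r f) (Dsg_zero X X)].

End Singularity.

Arguments ann_Dsg R : clear implicits.

(* Main.v *)
From HB Require Import structures.
From mathcomp Require Import all_boot all_order all_algebra.
From mathcomp Require Import boolp classical_sets functions.
From mathcomp Require Import zify.
Require Import Defs.

(** An element r acts as zero on an object X of the singularity category when
    r id_X = 0 there, and the annihilator consists of the r that act as zero on
    all X ([ann_DsgE]).

    Let r belong to all the ca(M).  If k is the top degree in which X has
    cohomology, a map R^b[-k] -> X that hits generators of H^k(X) has a cone
    isomorphic to X in the singularity category, because R^b is perfect, and
    with no cohomology in degree k.  After finitely many such steps X has
    become a shift of a finitely generated module M ([acts_as_zero_ca_mod]).
    Continuing in the same way replaces M by its syzygies, up to shifts.  If r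
    kills Ext^i(M, -) for i > n, then r kills Ext^1(K, -) for the n-th syzygy
    K, so multiplication by r on K factors through a free module
    ([ca_at1_factor]) and is zero in the singularity category
    ([acts_as_zero_stalk]).

    Conversely, an equality r id_X = 0 in a localization has to be turned into
    a statement about Ext.  For this no calculus of fractions is set up: the
    equality is tested by the functors that send X to the homotopy classes of
    chain maps t -> X, for t a bounded complex of free modules of finite rank.
    They invert quasi-isomorphisms because t consists of projectives
    ([acyclic_vanishes]).  If the dual of t is exact in the degrees at
    distance less than about n from 0, then maps t -> R[j] are null-homotopic
    for j small compared to n; by a thick subcategory argument so are all maps from t to a
    given perfect complex once n is large ([perfect_eventually_vanishes]).
    Therefore a morphism with perfect cone induces bijections for all large n,
    and the functors factor through the singularity category, as long as their
    values are compared only for large n ([loc_act_eqm]).  It follows that r f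
    is null-homotopic for all chain maps f : t -> X with n large
    ([acts_as_zero_null_homotopic]).

    This is applied to a free resolution P of M, and to the complex t that
    begins with d : P_n -> P_(n-1) and continues with the dual of a free
    resolution of the Auslander transpose, the cokernel of the dual of d.  The
    identities of P_n and P_(n-1) extend to a chain map t -> P, and a homotopy
    from r times it to 0 yields h : P_(n-1) -> P_n with r d = d h d
    ([syzygy_factor]): multiplication by r on the n-th syzygy factors through
    a projective module.  This property passes to any other projective
    resolution of M ([syzygy_factors_transfer]) and makes r kill Ext^n(M, -)
    ([Ext_killed]). *)

Set Implicit Arguments.
Unset Strict Implicit.
Unset Printing Implicit Defensive.
Import GRing.Theory Num.Theory Order.TTheory.
Local Open Scope ring_scope.

(** * Cohomology in terms of elements *)

Section Elements.
Variable R : comPzRingType.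
Implicit Types X Y : complex R.

Lemma degree_castK X i (x : X i) : degree_cast i x = x.
Proof. by rewrite /degree_cast; case: eqP => // e; rewrite eq_axiomK. Qed.

Lemma degree_cast_neq X i j (x : X i) : i != j -> degree_cast j x = 0.
Proof. by rewrite /degree_cast; case: eqP. Qed.

Lemma degree_castKK X i j (x : X i) :
  i = j -> degree_cast i (degree_cast j x) = x.
Proof. by move=> e; case: _ / e; rewrite !degree_castK. Qed.

Definition cocycle X i (x : X i) : Prop := cpx_diff X i (i + 1) x = 0.
(** The source degree j is left free: the differentials from the degrees other
    than i - 1 vanish, and no transport along i - 1 + 1 = i is needed. *)
Definition coboundary X i (x : X i) : Prop :=
  exists j (w : X j), cpx_diff X j i w = x.

Lemma cocycle_all X i j (x : X i) : cocycle x -> cpx_diff X i j x = 0.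
Proof.
rewrite /cocycle => x0; have [<-//|ij] := eqVneq (i + 1) j.
by rewrite cpx_shape.
Qed.

Lemma coboundary0 X i : coboundary (0 : X i).
Proof. by exists i, 0; rewrite linear0. Qed.

Lemma coboundary_pred X i j (x : X j) : i + 1 = j -> coboundary x ->
  exists w : X i, cpx_diff X i j w = x.
Proof.
move=> ij [k [w <-]]; have [kj|kj] := eqVneq (k + 1) j.
  have /eqP ik : i == k by rewrite -(inj_eq (addIr 1)) ij kj.
  by subst k; exists w.
by exists 0; rewrite linear0 cpx_shape.
Qed.

Lemma coboundaryD X i (x y : X i) : coboundary x -> coboundary y -> coboundary (x + y).
Proof.
have e : i - 1 + 1 = i by rewrite subrK.
move=> /(coboundary_pred e)[u <-] /(coboundary_pred e)[v <-].
by exists (i - 1), (u + v); rewrite linearD.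
Qed.

Lemma coboundaryZ X i r (x : X i) : coboundary x -> coboundary (r *: x).
Proof. by case=> j [w <-]; exists j, (r *: w); rewrite linearZ. Qed.

Lemma coboundaryN X i (x : X i) : coboundary x -> coboundary (- x).
Proof. by case=> j [w <-]; exists j, (- w); rewrite linearN. Qed.

Lemma cocycleD X i (x y : X i) : cocycle x -> cocycle y -> cocycle (x + y).
Proof. by rewrite /cocycle linearD => -> ->; rewrite addr0. Qed.

Lemma cocycleZ X i r (x : X i) : cocycle x -> cocycle (r *: x).
Proof. by rewrite /cocycle linearZ => /= ->; rewrite scaler0. Qed.

Lemma cocycle0 X i : cocycle (0 : X i).
Proof. by rewrite /cocycle linear0. Qed.

Lemma cocycleN X i (x : X i) : cocycle x -> cocycle (- x).
Proof. by rewrite /cocycle linearN => ->; rewrite oppr0. Qed.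

Lemma cocycle_sum X i n (c : 'I_n -> R) (x : 'I_n -> X i) :
  (forall k, cocycle (x k)) -> cocycle (\sum_k c k *: x k).
Proof.
move=> xc; elim/big_ind: _ => [|y z|k _]; [exact: cocycle0|exact: cocycleD|].
exact/cocycleZ.
Qed.

Lemma cm_cocycle X Y (f : chain_map X Y) i (x : X i) : cocycle x -> cocycle (f i x).
Proof. by rewrite /cocycle -cm_comm => ->; rewrite linear0. Qed.

Lemma cm_coboundary X Y (f : chain_map X Y) i (x : X i) : coboundary x -> coboundary (f i x).
Proof. by case=> j [w <-]; exists j, (f j w); rewrite cm_comm. Qed.

Lemma degree_cast_diff X i j k (x : X i) :
  j = k -> degree_cast k (cpx_diff X i j x) = cpx_diff X i k x.
Proof. by move=> e; case: _ / e; rewrite degree_castK. Qed.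

Lemma degree_cast_coboundary X i j (x : X i) :
  i = j -> coboundary (degree_cast j x) <-> coboundary x.
Proof. by move=> e; case: _ / e; rewrite degree_castK. Qed.

End Elements.

Section HomologyClasses.
Variables (R : comPzRingType) (U V W : lmodType R).
Variables (f : {linear U -> V}) (g : {linear V -> W}).

Lemma homology_class_eq (v w : cycles g) :
  homology_class f v = homology_class f w <-> exists u, f u = val v - val w.
Proof.
have E : (homology_class f v == homology_class f w) = (v - w \in boundaries f g).
  by rewrite Quotient.idealrBE.
split=> [/eqP|[u fu]].
  by rewrite E => /asboolP[u fu]; exists u; rewrite fu raddfB.
by apply/eqP; rewrite E; apply/asboolP; exists u; rewrite fu raddfB.
Qed.

Lemma homology_reprK (c : homology f g) :
  homology_class f (homology_repr c) = c.
Proof. exact: reprK. Qed.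

Lemma homology_class_linear : linear (@homology_class _ _ _ _ f g).
Proof.
move=> r v w; rewrite [LHS]Quotient.pi_add; congr (_ + _).
apply/homology_class_eq.
have /homology_class_eq[u fu] := esym (homology_reprK (homology_class f v)).
by exists (r *: u); rewrite linearZ /= fu -scalerBr.
Qed.

HB.instance Definition _ :=
  GRing.isLinear.Build R (cycles g) (homology f g) *:%R (@homology_class _ _ _ _ f g)
    homology_class_linear.

End HomologyClasses.

Section QuasiIso.
Variable R : comPzRingType.
Implicit Types X Y : complex R.

Lemma cocycle_pred X i (x : X i) : cocycle x -> cycle_pred (cpx_diff X i (i + 1)) x.
Proof. by move=> x0; apply/eqP. Qed.

Definition coh_class X i (x : X i) (x0 : cocycle x) : cohomology X i :=
  homology_class _ (Cycle (cocycle_pred x0)).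

Lemma coh_class_eq X i (x y : X i) (x0 : cocycle x) (y0 : cocycle y) :
  coh_class x0 = coh_class y0 <-> coboundary (x - y).
Proof.
rewrite /coh_class; split=> [/homology_class_eq[u /= uE]|xy].
  by exists (i - 1), u.
by apply/homology_class_eq; apply: coboundary_pred xy; rewrite subrK.
Qed.

Lemma coh_class_onto X i (c : cohomology X i) :
  exists (x : X i) (x0 : cocycle x), c = coh_class x0.
Proof.
case E : (homology_repr c) => [x xP].
have x0 : cocycle x by apply/eqP.
exists x, x0; rewrite -[c]homology_reprK; apply/homology_class_eq.
by exists 0; rewrite linear0 E /= subrr.
Qed.

Lemma coh_class_map X Y (f : chain_map X Y) i (x : X i) (x0 : cocycle x) :
  cohomology_map f (coh_class x0) = coh_class (cm_cocycle f x0).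
Proof.
rewrite /cohomology_map /homology_map; apply/homology_class_eq => /=.
set z := homology_repr _.
have /homology_class_eq[u /= uE] := homology_reprK (coh_class x0).
by exists (f _ u); rewrite -cm_comm uE linearB.
Qed.

(** All quasi-isomorphisms below are recognized by this criterion, on cocycles
    instead of cohomology classes. *)
Lemma quasi_isoP X Y (f : chain_map X Y) :
  quasi_iso f <-> forall i,
    (forall x : X i, cocycle x -> coboundary (f i x) -> coboundary x) /\
    (forall y : Y i, cocycle y -> exists2 x : X i, cocycle x & coboundary (y - f i x)).
Proof.
split=> [fq i|H i].
  have [h hK Kh] := fq i; split=> [x x0 fx|y y0].
    have z0 := cocycle0 X i.
    rewrite -[x]subr0 -(coh_class_eq x0 z0); apply: (can_inj hK).
    by rewrite !coh_class_map; apply/coh_class_eq; rewrite linear0 subr0.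
  have [x [x0 xE]] := coh_class_onto (h (coh_class y0)).
  exists x => //; have := Kh (coh_class y0).
  by rewrite xE coh_class_map => /esym/coh_class_eq.
have [inj surj] := H i.
have fI : injective (cohomology_map f (i := i)).
  move=> c c'; have [x [x0 ->]] := coh_class_onto c.
  have [y [y0 ->]] := coh_class_onto c'.
  rewrite !coh_class_map => /coh_class_eq; rewrite -linearB => fxy.
  by apply/coh_class_eq/inj => //; apply: cocycleD => //; apply: cocycleN.
have fS (c : cohomology Y i) : exists d : cohomology X i, cohomology_map f d = c.
  have [y [y0 ->]] := coh_class_onto c; have [x x0 yx] := surj y y0.
  by exists (coh_class x0); rewrite coh_class_map; apply/esym/coh_class_eq.
pose h c := sval (cid (fS c)).

have hK : cancel h (cohomology_map f (i := i)).
  by move=> c; rewrite /h; case: cid.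
by exists h => // c; apply: fI; rewrite hK.
Qed.

Definition acyclic_at X i := forall x : X i, cocycle x -> coboundary x.

Definition coh_fg X i := exists n (g : 'I_n -> X i),
  (forall k, cocycle (g k)) /\
  forall x, cocycle x -> exists c : 'I_n -> R, coboundary (x - \sum_k c k *: g k).

Lemma coh_class_sum X i n (c : 'I_n -> R) (g : 'I_n -> X i)
    (gc : forall k, cocycle (g k)) (x : X i) (x0 : cocycle x) :
  coboundary (x - \sum_k c k *: g k) <->
  coh_class x0 = \sum_k c k *: coh_class (gc k).
Proof.
have E : \sum_k c k *: coh_class (gc k) = coh_class (cocycle_sum c gc).
  rewrite /coh_class; under eq_bigr do rewrite -linearZ.
  rewrite -raddf_sum; congr homology_class; apply: val_inj.
  by rewrite raddf_sum /=.
by rewrite E coh_class_eq.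
Qed.

End QuasiIso.

(** * Complexes with finitely generated total cohomology *)

Section TotalCohomology.
Variable R : comPzRingType.
Implicit Type X : complex R.

Definition single X i (c : cohomology X i) : forall j, cohomology X j :=
  dfwith (fun j => 0 : cohomology X j) c.

Lemma single_id X i (c : cohomology X i) : single c i = c.
Proof. exact: dfwith_in. Qed.

Lemma single_neq X i j (c : cohomology X i) : i != j -> single c j = 0.
Proof. by move=> ij; rewrite /single dfwith_out. Qed.

Lemma coh_class0 X i (x : X i) (x0 : cocycle x) : coh_class x0 = 0 <-> coboundary x.
Proof.
have -> : (0 : cohomology X i) = coh_class (cocycle0 X i).
  rewrite /coh_class -[LHS](linear0 (@homology_class _ _ _ _ _ _)).
  by congr homology_class; apply: val_inj.
by rewrite coh_class_eq subr0.
Qed.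

(** Finitely many generators of the direct sum are supported in finitely many
    degrees, so the cohomology vanishes in the others. Conversely, when only
    finitely many degrees matter, generators in each of them generate
    together. *)
Lemma total_cohomology_fin_genP X :
  total_cohomology_fin_gen X <->
  (exists N : nat, forall i : int, (N < `|i|)%N -> acyclic_at X i) /\
  (forall i, coh_fg X i).
Proof.
split=> [[n [g [gs gen]]]|[[N XN] Xfg]].
  split.
    have [s sP] := choice gs.
    pose s' := flatten [seq s k | k <- enum 'I_n].
    exists (\max_(j <- s') `|j|%N)%N => i iN x x0.
    have is' : i \notin s'.
      apply: contraL iN => /(leq_bigmax_seq (F := fun j : int => `|j|%N)).
      by rewrite -leqNgt; apply.
    have gi k : g k i = 0.
      apply: sP; apply: contra is' => ik; apply/flattenP; exists (s k) => //.
      by apply: map_f; rewrite mem_enum.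
    have [|c cE] := gen (single (coh_class x0)).
      exists [:: i] => j; rewrite inE eq_sym; exact: single_neq.
    apply/(coh_class0 x0); rewrite -[LHS]single_id cE.
    by rewrite big1 // => k _; rewrite gi scaler0.
  move=> i; exists n.
  have gr (k : 'I_n) : exists x : X i, exists x0 : cocycle x, g k i = coh_class x0.
    exact: coh_class_onto.
  have [h hP] := choice gr; 
  have h0 k : cocycle (h k) by have [] := hP k.
  have hE k : g k i = coh_class (h0 k).
    have [hk ->] := hP k; apply/coh_class_eq; rewrite subrr; exact: coboundary0.
  exists h; split=> // x x0.
  have [|c cE] := gen (single (coh_class x0)).
    exists [:: i] => j; rewrite inE eq_sym; exact: single_neq.
  exists c; apply/(coh_class_sum c h0 x0); rewrite -[LHS]single_id cE.
  by apply: eq_bigr => k _; rewrite hE.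
have fgs (s : seq int) : exists n (g : 'I_n -> forall i, cohomology X i),
    (forall k i, i \notin s -> g k i = 0) /\
    forall x : forall i, cohomology X i, (forall i, i \notin s -> x i = 0) ->
    exists c : 'I_n -> R, forall i, x i = \sum_(k < n) c k *: g k i.
  elim: s => [|i s [n [g [gs gen]]]].
    exists 0%N, (fun k j => 0); split=> // x x0.
    by exists (fun=> 0) => i; rewrite big_ord0 x0.
  have [m [h [hc hgen]]] := Xfg i.
  pose G (k : 'I_(m + n)) := match fintype.split k with
    | inl a => single (coh_class (hc a)) | inr b => g b end.
  exists (m + n)%N, G; split.
    move=> k j; rewrite inE negb_or => /andP[ji js]; rewrite /G.
    by case: fintype.splitP => a _; [rewrite single_neq // eq_sym|exact: gs].
  move=> x xs.
  have [y [y0 yE]] := coh_class_onto (x i).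
  have [c cE] := hgen _ y0.
  pose x' j := x j - \sum_(a < m) c a *: single (coh_class (hc a)) j.
  have [j js|c' c'E] := gen x'.
    rewrite /x'; have [ji|ji] := eqVneq j i.
      subst j; rewrite yE; move/(coh_class_sum _ hc y0): cE => ->.
      by rewrite -sumrB big1 // => k _; rewrite single_id subrr.
    rewrite xs ?inE ?negb_or ?ji // big1 ?subr0 // => k _.
    by rewrite single_neq ?scaler0 // eq_sym.
  exists (fun k : 'I_(m + n) => match fintype.split k with inl a => c a | inr b => c' b end) => j.
  rewrite big_split_ord /= -[LHS](subrK (\sum_(a < m) c a *: single (coh_class (hc a)) j)).
  rewrite -/(x' j) c'E addrC; congr (_ + _); apply: eq_bigr => k _; rewrite /G /=.
    by have -> : fintype.split (rshift m k) = inr k := unsplitK (inr k).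
  by have -> : fintype.split (lshift n k) = inl k := unsplitK (inl k).
have [n [g [gs gen]]] := fgs ([seq Posz k | k <- iota 0 N.+1] ++ [seq - Posz k | k <- iota 0 N.+1]).
have mem (i : int) : i \notin [seq Posz k | k <- iota 0 N.+1] ++ [seq - Posz k | k <- iota 0 N.+1] -> (N < `|i|)%N.
  rewrite mem_cat; apply: contraNltn => iN; apply/orP.
  case: (leP 0 i) => i0; [left|right]; apply/mapP; exists `|i|%N; rewrite ?mem_iota //=; lia.
exists n, g; split=> [k|x xs].
  by eexists; apply: gs.
apply: gen => i /mem/XN Xi.
by have [y [y0 ->]] := coh_class_onto (x i); apply/coh_class0/Xi.
Qed.

End TotalCohomology.

(** * Elements acting as zero in the singularity category *)

Section Categories.
Variable C : category.
Implicit Types X Y Z : C.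

Lemma eqm_compl X Y Z (g : hom Y Z) (f f' : hom X Y) :
  eqm f f' -> eqm (comp g f) (comp g f').
Proof. by move=> ff'; apply: eqm_comp => //; exact: eqm_refl. Qed.

Lemma eqm_compr X Y Z (g g' : hom Y Z) (f : hom X Y) :
  eqm g g' -> eqm (comp g f) (comp g' f).
Proof. by move=> gg'; apply: eqm_comp => //; exact: eqm_refl. Qed.

Lemma iso_cancell X Y Z (s : hom Y Z) (f f' : hom X Y) :
  is_iso s -> eqm (comp s f) (comp s f') -> eqm f f'.
Proof.
case=> t [ts _] E.
have H (h : hom X Y) : eqm (comp t (comp s h)) h.
  apply: eqm_trans (compA _ _ _) _; apply: eqm_trans (comp1m h).
  exact: eqm_compr.
apply: eqm_trans (eqm_sym (H f)) _; apply: eqm_trans (H f').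
exact: eqm_compl.
Qed.

Lemma iso_cancelr X Y Z (s : hom X Y) (f f' : hom Y Z) :
  is_iso s -> eqm (comp f s) (comp f' s) -> eqm f f'.
Proof.
case=> t [_ st] E.
have H (h : hom Y Z) : eqm (comp (comp h s) t) h.
  apply: eqm_trans (eqm_sym (compA _ _ _)) _; apply: eqm_trans (compm1 h).
  exact: eqm_compl.
apply: eqm_trans (eqm_sym (H f)) _; apply: eqm_trans (H f').
exact: eqm_compr.
Qed.

Lemma iso_id X : is_iso (idm X).
Proof. by exists (idm X); split; exact: comp1m. Qed.

Lemma isomorphic_refl X : isomorphic X X.
Proof. by exists (idm X); exact: iso_id. Qed.

Lemma isomorphic_sym X Y : isomorphic X Y -> isomorphic Y X.
Proof. by case=> f [g [gf fg]]; exists g, f. Qed.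

End Categories.

Section LocalizationFacts.
Variables (C : category) (W : forall X Y : C, hom X Y -> Prop).

Lemma loc_of_W (X Y : C) (s : hom X Y) :
  W s -> @is_iso (localization W) X Y (loc_of s).
Proof.
move=> Ws; exists (loc_inv Ws); split; [exact: loc_invl|exact: loc_invr].
Qed.

Lemma loc_of_iso (X Y : C) (s : hom X Y) :
  is_iso s -> @is_iso (localization W) X Y (loc_of s).
Proof.
case=> t [ts st]; exists (loc_of t); split.
  exact: loc_trans (loc_sym (loc_of_comp W t s)) (loc_of_eqm _ ts).
exact: loc_trans (loc_sym (loc_of_comp W s t)) (loc_of_eqm _ st).
Qed.

(** Localizing keeps terminal objects terminal: the equation z f = z is stable
    under composition, and for a formal inverse it follows by cancelling the
    inverted morphism. *)
Lemma localization_terminal (T : C) (z : forall X : C, hom X T) :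
  (forall (X Y : C) (f : hom X Y), eqm (comp (z Y) f) (z X)) ->
  forall (X Y : localization W) (f : hom X Y),
    eqm (c := localization W) (comp (loc_of (z Y) : @hom (localization W) Y T) f)
      (loc_of (z X)).
Proof.
move=> zP X Y f; elim: f => {X Y} [X Y f|X Y s Ws|X Y Z g IHg f IHf] /=.
- exact: loc_trans (loc_sym (loc_of_comp W _ f)) (loc_of_eqm _ (zP _ _ f)).
- have E : @eqm (localization W) _ _
      (comp (loc_of (z Y) : @hom (localization W) Y T) (loc_of s)) (loc_of (z X)).
    exact: loc_trans (loc_sym (loc_of_comp W _ s)) (loc_of_eqm _ (zP _ _ s)).
  apply: loc_trans (loc_cong (loc_sym E) (loc_refl _)) _.
  apply: loc_trans (loc_sym (loc_compA _ _ _)) _.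
  apply: loc_trans (loc_compm1 _); apply: loc_cong (loc_refl _) _.
  exact: loc_invr.
- apply: loc_trans (loc_compA _ _ _) _.
  exact: loc_trans (loc_cong IHg (loc_refl _)) IHf.
Qed.

End LocalizationFacts.

Section Null.
Variable R : comPzRingType.

Lemma in_D_comp (X Y Z : complex R) (g : chain_map Y Z) (f : chain_map X Y) :
  eqm (in_D (cm_comp g f)) (comp (in_D g) (in_D f)).
Proof. exact: (@loc_of_comp (complexes R) _ X Y Z g f). Qed.

Lemma in_D_eq (X Y : complex R) (f g : chain_map X Y) :
  (forall i x, f i x = g i x) -> eqm (in_D f) (in_D g).
Proof. exact: (@loc_of_eqm (complexes R) _ X Y f g). Qed.

Lemma in_D_quasi_iso (X Y : complex R) (f : chain_map X Y) :
  quasi_iso f -> is_iso (in_D f).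
Proof. exact: (@loc_of_W (complexes R) _ X Y f). Qed.

Lemma quasi_iso_isomorphic (X Y : complex R) (f : chain_map X Y) :
  quasi_iso f -> @isomorphic (D R) X Y.
Proof. by move=> fq; exists (in_D f); exact: in_D_quasi_iso. Qed.

Lemma cone_is_cone (X Y : complex R) (u : chain_map X Y) :
  is_cone (in_D u) (cone u).
Proof.
exists X, Y, u, (idm (X : D R)), (idm (Y : D R)); split.
- exact: iso_id.
- exact: iso_id.
- by apply: eqm_trans (compm1 _) _; apply: eqm_sym; exact: comp1m.
- exact: isomorphic_refl.
Qed.

Lemma perfect_thick : is_thick (@perfect R).
Proof.
split=> [X Y XY PX||n X PX|X Y s Z sZ PX PY|X Y PXY] T Tt TR.
- by apply: (thick_iso Tt XY); exact: PX.
- exact: thick_zero.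
- by apply: (thick_shift Tt); exact: PX.
- by apply: (thick_cone Tt sZ); [exact: PX|exact: PY].
- by apply: (thick_summand Tt); exact: PXY Tt TR.
Qed.

Implicit Types X Y Z : Dsg R.

Lemma in_Dsg_comp X Y Z (g : chain_map (sval Y) (sval Z))
    (f : chain_map (sval X) (sval Y)) :
  eqm (@in_Dsg R X Z (cm_comp g f)) (comp (in_Dsg g) (in_Dsg f)).
Proof.
apply: loc_trans (loc_of_comp _ (in_D g : @hom (Df R) Y Z) (in_D f : @hom (Df R) X Y)).
exact: (@loc_of_eqm (Df R) _ X Z) (in_D_comp g f).
Qed.

Lemma in_Dsg_eq X Y (f g : chain_map (sval X) (sval Y)) :
  (forall i x, f i x = g i x) -> eqm (@in_Dsg R X Y f) (in_Dsg g).
Proof. by move=> fg; exact: (@loc_of_eqm (Df R) _ X Y) (in_D_eq fg). Qed.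

Lemma in_Dsg_quasi_iso X Y (f : chain_map (sval X) (sval Y)) :
  quasi_iso f -> is_iso (@in_Dsg R X Y f).
Proof.
move=> /in_D_quasi_iso fi; exact: (@loc_of_iso (Df R) _ X Y).
Qed.

Lemma in_Dsg_perfect_cone X Y (f : chain_map (sval X) (sval Y)) :
  perfect (cone f) -> is_iso (@in_Dsg R X Y f).
Proof.
move=> fp; apply: (@loc_of_W (Df R) _ X Y); exists (cone f) => //.
exact: cone_is_cone.
Qed.

Definition acts_as_zero (r : R) X :=
  eqm (@in_Dsg R X X (cm_scale r (sval X))) (@in_Dsg R X X (cm_zero (sval X) (sval X))).

(** Multiplication by r commutes with every chain map s, so its vanishing can
    be carried across s once s is invertible. *)
Lemma acts_as_zero_iso r X Y (s : chain_map (sval X) (sval Y)) :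
  is_iso (@in_Dsg R X Y s) -> acts_as_zero r X <-> acts_as_zero r Y.
Proof.
move=> si.
have rs : eqm (comp (@in_Dsg R Y Y (cm_scale r (sval Y))) (in_Dsg s))
    (comp (in_Dsg s) (@in_Dsg R X X (cm_scale r (sval X)))).
  apply: eqm_trans (in_Dsg_comp _ _); apply: eqm_trans (eqm_sym (in_Dsg_comp _ _)) _.
  by apply: in_Dsg_eq => i x /=; rewrite linearZ.
have zs : eqm (comp (@in_Dsg R Y Y (cm_zero (sval Y) (sval Y))) (in_Dsg s))
    (comp (in_Dsg s) (@in_Dsg R X X (cm_zero (sval X) (sval X)))).
  apply: eqm_trans (in_Dsg_comp _ _); apply: eqm_trans (eqm_sym (in_Dsg_comp _ _)) _.
  by apply: in_Dsg_eq => i x /=; rewrite linear0.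
split=> [X0|Y0].
  apply: iso_cancelr si _; apply: eqm_trans rs _; apply: eqm_trans (eqm_sym zs).
  exact: eqm_compl.
apply: iso_cancell si _; apply: eqm_trans (eqm_sym rs) _; apply: eqm_trans zs.
exact: eqm_compr.
Qed.

Lemma rV0_eq0 (v : 'rV[R]_0) : v = 0.
Proof. by apply/rowP => -[]. Qed.

Lemma zero_complex_Df : total_cohomology_fin_gen (zero_complex R).
Proof.
apply/total_cohomology_fin_genP; split.
  exists 0%N => i _ x _; exists i, 0; rewrite /= ; exact/esym/rV0_eq0.
move=> i; exists 0%N, (fun=> 0); split=> [[]//|x _].
by exists (fun=> 0); rewrite [_ - _]rV0_eq0; exact: coboundary0.
Qed.

Definition Dsg0 : Dsg R := exist _ _ zero_complex_Df.

Lemma Dsg0_terminal X Y (f : hom X Y) :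
  eqm (comp (@in_Dsg R Y Dsg0 (cm_zero _ _)) f) (@in_Dsg R X Dsg0 (cm_zero _ _)).
Proof.
pose zD (A : complex R) : @hom (D R) A (zero_complex R) := in_D (cm_zero A (zero_complex R)).
pose zDf (A : Df R) : @hom (Df R) A Dsg0 := zD (sval A).
apply: (@localization_terminal (Df R) _ Dsg0 zDf) => {X Y f} X Y f.
apply: (@localization_terminal (complexes R) _ _ (fun A => cm_zero A (zero_complex R))).
by move=> A B g i x.
Qed.

(** The zero map factors through the zero complex, which is still terminal
    after both localizations. *)
Lemma Dsg_zero_comp X Y (f : hom X Y) :
  eqm (comp (@in_Dsg R Y Y (cm_zero _ _)) f) (@in_Dsg R X Y (cm_zero _ _)).
Proof.
have E A : eqm (@in_Dsg R A Y (cm_zero _ _))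
    (comp (@in_Dsg R Dsg0 Y (cm_zero _ _)) (@in_Dsg R A Dsg0 (cm_zero _ _))).
  by apply: eqm_trans (in_Dsg_comp _ _); apply: in_Dsg_eq => i x /=; rewrite ?linear0.
apply: eqm_trans (eqm_compr f (E Y)) _; apply: eqm_trans (eqm_sym (E X)).
apply: eqm_trans (eqm_sym (compA _ _ _)) _; apply: eqm_compl.
exact: Dsg0_terminal.
Qed.

(** Since r f = (r id) f, only identities have to be considered. *)
Lemma ann_DsgE r : ann_Dsg R r <-> forall X, acts_as_zero r X.
Proof.
split=> [rA X|rN X f].
  apply: eqm_trans (rA X (idm X)); apply: eqm_sym; exact: compm1.
apply: eqm_trans (eqm_compr f (rN X)) _; exact: Dsg_zero_comp.
Qed.

(** A perfect complex Q is a zero object of the singularity category, as the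
    cone of Q -> 0 is perfect; a map that factors through Q is therefore
    unchanged when the identity of Q is replaced by 0. *)
Lemma acts_as_zero_factor r X (Q : Dsg R) (p : chain_map (sval Q) (sval X))
    (s : chain_map (sval X) (sval Q)) :
  perfect (sval Q) -> (forall i x, p i (s i x) = r *: x) -> acts_as_zero r X.
Proof.
move=> Qp psr; have Tt := perfect_thick.
have zi : is_iso (@in_Dsg R Q Dsg0 (cm_zero _ _)).
  apply: in_Dsg_perfect_cone; apply: (thick_cone Tt) (cone_is_cone _) _ _ => //.
  exact: (thick_zero Tt).
have Q0 : eqm (idm Q) (@in_Dsg R Q Q (cm_zero _ _)).
  apply: iso_cancell zi _; apply: eqm_trans (compm1 _) _.
  apply: eqm_trans (in_Dsg_comp _ _); exact: in_Dsg_eq.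
have E : eqm (@in_Dsg R X X (cm_scale r (sval X))) (comp (in_Dsg p) (in_Dsg s)).
  by apply: eqm_trans (in_Dsg_comp _ _); apply: in_Dsg_eq => i x /=; rewrite psr.
apply: eqm_trans E _; apply: eqm_trans (eqm_compl _ (eqm_sym (comp1m _))) _.
apply: eqm_trans (eqm_compl _ (eqm_compr _ Q0)) _.
apply: eqm_trans (eqm_compl _ (eqm_sym (in_Dsg_comp _ _))) _.
apply: eqm_trans (eqm_sym (in_Dsg_comp _ _)) _.
by apply: in_Dsg_eq => i x /=; rewrite linear0.
Qed.

End Null.

(** * Cones and stalk complexes *)

(** Replacing a degree by a successor lets the differential into it be written
    without subtraction. *)
Lemma int_succ (P : int -> Prop) : (forall i, P (i + 1)) -> forall j, P j.
Proof. by move=> H j; rewrite -[j](subrK 1); exact: H. Qed.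

Section Linear.
Variables (R : comPzRingType) (U V : lmodType R).

Definition mklin (f : U -> V) (lf : linear f) : {linear U -> V} :=
  HB.pack f (GRing.isLinear.Build R U V *:%R f lf).

End Linear.

Lemma pair_add (U V : zmodType) (a c : U) (b d : V) :
  (a, b) + (c, d) = (a + c, b + d).
Proof. by []. Qed.

Section Cones.
Variable R : comPzRingType.
Variables (X Y : complex R) (u : chain_map X Y).

Lemma cone_diffE i (z : cone u i) :
  cpx_diff (cone u) i (i + 1) z =
  (cpx_diff Y i (i + 1) z.1 + u (i + 1) z.2,
   - cpx_diff X (i + 1) (i + 1 + 1) z.2).
Proof. by rewrite /= /cone_diff degree_castK. Qed.

Lemma cone_cocycle i (z : cone u i) :
  cocycle z <-> cpx_diff Y i (i + 1) z.1 + u (i + 1) z.2 = 0 /\ cocycle z.2.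
Proof.
rewrite /cocycle cone_diffE; split=> [[-> /eqP]|[-> ->]]; last by rewrite oppr0.
by rewrite oppr_eq0 => /eqP.
Qed.

Lemma cone_cocycleP i (y : Y i) (x : X (i + 1)) :
  cocycle ((y, x) : cone u i) <-> cpx_diff Y i (i + 1) y + u (i + 1) x = 0 /\ cocycle x.
Proof. exact: cone_cocycle. Qed.

Lemma cone_coboundary i (y : Y (i + 1)) (x : X (i + 1 + 1)) :
  coboundary ((y, x) : cone u (i + 1)) <-> exists (w : Y i) (v : X (i + 1)),
    y = cpx_diff Y i (i + 1) w + u (i + 1) v /\
    x = - cpx_diff X (i + 1) (i + 1 + 1) v.
Proof.
split=> [/(coboundary_pred erefl)[[w v]]|[w [v [-> ->]]]].
  by rewrite cone_diffE => -[<- <-]; exists w, v.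
by exists i, (w, v); rewrite cone_diffE.
Qed.

Lemma cone_in_linear i : linear (fun y : Y i => (y, 0) : cone u i).
Proof. by move=> r y z; congr (_, _); rewrite /= scaler0 addr0. Qed.

Definition cone_in : chain_map Y (cone u).
Proof.
exists (fun i => mklin (@cone_in_linear i)) => i j y /=.
by rewrite /cone_diff /= !linear0 addr0.
Defined.

End Cones.

Section ConeOfConeIn.
Variable R : comPzRingType.
Variables (X Y : complex R) (u : chain_map X Y).

Lemma cone_out_linear i :
  linear (fun z : cone (cone_in u) i => z.1.2 : shift 1 X i).
Proof. by []. Qed.

Definition cone_out : chain_map (cone (cone_in u)) (shift 1 X).
Proof.
exists (fun i => mklin (@cone_out_linear i)) => i j [[y a] y'] /=.
by rewrite expr1 scaleN1r addr0.
Defined.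

Lemma shift_cocycle n i (x : shift n X i) :
  cocycle x <-> cpx_diff X (i + n) (i + 1 + n) x = 0.
Proof.
rewrite /cocycle /=; split=> [/(congr1 (fun y => (-1) ^+ `|n|%N *: y))|->]; last first.
  by rewrite scaler0.
by rewrite scaler0 scalerA -expr2 sqrr_sign scale1r.
Qed.

(** Rotation of the triangle: the cone of Y -> cone u is an extension of X[1]
    by the contractible cone of the identity of Y. *)
Lemma cone_out_quasi_iso : quasi_iso cone_out.
Proof.
apply/quasi_isoP; apply: int_succ => i; split=> [[[y a] y']|a].
  move=> /cone_cocycle[]; rewrite cone_diffE /= => -[] /eqP + _ _.
  rewrite addr_eq0 => /eqP yE /(coboundary_pred erefl)[/= w].
  rewrite expr1 scaleN1r => wa.
  apply/cone_coboundary; exists (0, w), (y - u _ w); split.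
    by rewrite cone_diffE /= linear0 add0r wa pair_add addr0 [u _ w + _]addrC subrK.
  by rewrite linearB /= -cm_comm -[cpx_diff _ _ _ w]opprK wa linearN opprK yE opprK.
move=> /shift_cocycle a0.
(* The last component cancels the contribution of u a to the differential. *)
exists ((0, a), - u _ a); last by rewrite /= subrr; exact: coboundary0.
apply/cone_cocycle; rewrite cone_diffE /= linear0 add0r; split=> /=.
  by rewrite pair_add subrr addr0 a0 oppr0.
by rewrite /cocycle linearN -cm_comm a0 linear0 oppr0.
Qed.

(** Gluing a perfect complex X to Y does not change Y in the singularity
    category. *)
Lemma perfect_cone_in : perfect X -> perfect (cone (cone_in u)).
Proof.
move=> PX; apply: (thick_iso (@perfect_thick R)).
  exact: isomorphic_sym (quasi_iso_isomorphic cone_out_quasi_iso).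
exact: (thick_shift (@perfect_thick R)).
Qed.

End ConeOfConeIn.

Section CycleVal.
Variables (R : comPzRingType) (V W : lmodType R) (g : {linear V -> W}).

Lemma cycle_val_linear : linear (@cycle_val R V W g).
Proof. by []. Qed.

HB.instance Definition _ :=
  GRing.isLinear.Build R (cycles g) V *:%R (@cycle_val R V W g) cycle_val_linear.

End CycleVal.

Section Stalk.
Variables (R : comPzRingType) (k : int).
Implicit Types M N : lmodType R.

(** Its kernel is M when i = k and 0 otherwise. With kernels as terms, all
    degrees of a stalk complex consist of elements of M, and maps between
    stalk complexes need no transport along i = k. *)
Definition stalk_test M (i : int) : {linear M -> M} :=
  if i == k then \0 : {linear M -> M} else idfun : {linear M -> M}.

Definition stalk_at M : complex R :=
  @Complex R (fun i => cycles (stalk_test M i)) (fun i j => \0)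
    (fun i j x _ => erefl) (fun i j l x => erefl).

Lemma stalk_testP M i (m : M) :
  cycle_pred (stalk_test M i) m <-> i = k \/ m = 0.
Proof.
rewrite /cycle_pred /stalk_test; have [ik|/eqP ik] := eqVneq i k.
  by rewrite /= eqxx; split=> // _; left.
by split=> [/eqP|[//|->]]; [right|rewrite linear0].
Qed.

Lemma stalk_valP M i (z : stalk_at M i) : i = k \/ cycle_val z = 0.
Proof. exact/stalk_testP/cycleP. Qed.

Definition stalk_el M i (ik : i = k) (m : M) : stalk_at M i :=
  Cycle (proj2 (stalk_testP i m) (or_introl ik)).

Lemma stalk_eq M i (y z : stalk_at M i) : cycle_val y = cycle_val z -> y = z.
Proof. exact: val_inj. Qed.

Lemma stalk_eq0 M i (z : stalk_at M i) : i <> k -> z = 0.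
Proof. by move=> ik; apply: stalk_eq; case: (stalk_valP z). Qed.

Lemma stalk_coboundary M i (z : stalk_at M i) : coboundary z <-> z = 0.
Proof. by split=> [[j [w <-]]|->] //; exact: coboundary0. Qed.

Section StalkMap.
Variables (M : lmodType R) (Y : complex R) (f : {linear M -> Y k}).
Hypothesis f_cocycle : forall m, cocycle (f m).

Lemma stalk_map_linear i :
  linear (fun z : stalk_at M i => degree_cast i (f (cycle_val z))).
Proof. by move=> r y z; rewrite -linearP -linearP. Qed.

Definition stalk_map : chain_map (stalk_at M) Y.
Proof.
exists (fun i => mklin (@stalk_map_linear i)) => i j z /=; rewrite linear0 linear0.
move: (f _) (f_cocycle (cycle_val z)) => {z} y y0.
have [<-|ik] := eqVneq k i; first by rewrite degree_castK (cocycle_all _ y0).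
by rewrite degree_cast_neq ?linear0.
Defined.

Lemma stalk_mapE (z : stalk_at M k) : stalk_map k z = f (cycle_val z).
Proof. exact: degree_castK. Qed.

End StalkMap.

Section StalkFun.
Variables (M N : lmodType R) (f : {linear M -> N}).

Lemma stalk_fun_proof i (z : stalk_at M i) :
  cycle_pred (stalk_test N i) (f (cycle_val z)).
Proof.
by apply/stalk_testP; case: (stalk_valP z) => [|->]; [left|right; rewrite linear0].
Qed.

Lemma stalk_fun_linear i :
  linear (fun z : stalk_at M i => Cycle (stalk_fun_proof z) : stalk_at N i).
Proof. by move=> r y z; apply: stalk_eq; rewrite /= linearP. Qed.

Definition stalk_fun : chain_map (stalk_at M) (stalk_at N).
Proof.
exists (fun i => mklin (@stalk_fun_linear i)) => i j z /=.
by apply: stalk_eq; rewrite /= linear0.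
Defined.

End StalkFun.

Lemma stalk_Df M : fin_gen M -> total_cohomology_fin_gen (stalk_at M).
Proof.
move=> [n [g gP]]; apply/total_cohomology_fin_genP; split.
  exists `|k|%N => i ik z _; apply/stalk_coboundary/stalk_eq0 => ik'.
  by rewrite ik' ltnn in ik.
move=> i; have [ik|/eqP ik] := eqVneq i k.
  exists n, (fun a => stalk_el ik (g a)); split=> // z _.
  have [c cE] := gP (cycle_val z); exists c; apply/stalk_coboundary; apply: stalk_eq.
  by rewrite raddfB raddf_sum /= cE subrr.
exists 0%N, (fun=> 0); split=> [[]//|z _].
by exists (fun=> 0); apply/stalk_coboundary/stalk_eq0.
Qed.

End Stalk.

(** * Free stalk complexes are perfect *)

Section PerfectStalks.
Variable R : comPzRingType.

Lemma stalk_mod_eq0 (M : lmodType R) n (y : stalk_mod M n) : n != 0 -> y = 0.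
Proof.
by rewrite /stalk_mod in y *; case: (n == 0) y => // y _; exact: rV0_eq0.
Qed.

Lemma stalk_el_linear k (M : lmodType R) :
  linear (fun m : M => degree_cast (k - k) (m : stalk M 0) : shift (- k) (stalk M) k).
Proof. by move=> r x y; exact: (linearP (@degree_cast _ (stalk M) 0 (k - k))). Qed.

Lemma shift_stalk_cocycle k (M : lmodType R) i (x : shift (- k) (stalk M) i) : cocycle x.
Proof. by rewrite /cocycle /= scaler0. Qed.

Definition stalk_to_shift k (M : lmodType R) :
    chain_map (stalk_at k M) (shift (- k) (stalk M)) :=
  stalk_map (f := mklin (@stalk_el_linear k M)) (fun m => shift_stalk_cocycle _).

(** The two models of a module placed in degree k, as a family of submodules
    and as a shift of the stalk in degree 0, agree in the derived category. *)
Lemma stalk_to_shift_quasi_iso k M : quasi_iso (stalk_to_shift k M).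
Proof.
apply/quasi_isoP => i; have [ik|/eqP ik] := eqVneq i k; last first.
  split=> [x _ _|y _]; first by rewrite (stalk_eq0 x ik); exact: coboundary0.
  exists 0 => //; rewrite linear0 subr0 [y]stalk_mod_eq0 ?subr_eq0; last exact/eqP.
  exact: coboundary0.
case: _ / ik; split=> [x _ [j [w]]|y _].
  rewrite stalk_mapE /= scaler0 => /(congr1 (@degree_cast _ (stalk M) (i - i) 0)).
  rewrite linear0 degree_castKK ?subrr // => x0.
  by apply/stalk_coboundary/stalk_eq; rewrite -x0.
exists (stalk_el erefl (@degree_cast _ (stalk M) (i - i) 0 y)) => //.
by rewrite stalk_mapE /= degree_castKK ?subrr //; exact: coboundary0.
Qed.

Lemma perfect_stalk_R k : perfect (stalk_at k (R^o : lmodType R)).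
Proof.
move=> T Tt TR; apply: (thick_iso Tt _ (thick_shift Tt (- k) TR)).
exact: isomorphic_sym (quasi_iso_isomorphic (stalk_to_shift_quasi_iso k _)).
Qed.

Section Join.
Variables (k : int) (b : nat).
Let X := stalk_at (k + 1) (R^o : lmodType R).
Let Y := stalk_at k ('rV[R]_b : lmodType R).

(** A free module of rank 1 + b in degree k is the cone of the zero map from R
    in degree k + 1 to R^b in degree k. *)
Lemma join_proof i (z : cone (cm_zero X Y) i) :
  cycle_pred (stalk_test k _ i)
    (row_mx (cycle_val z.2)%:M (cycle_val z.1) : 'rV[R]_(1 + b)).
Proof.
apply/stalk_testP; case: (stalk_valP z.1) => [|->]; [by left|].
case: (stalk_valP z.2) => [/(addIr 1)|->]; first by left.
by right; rewrite raddf0 row_mx0.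
Qed.

Lemma join_linear i :
  linear (fun z => Cycle (join_proof z) : stalk_at k ('rV[R]_(1 + b)) i).
Proof.
move=> r y z; apply: stalk_eq; rewrite /= scale_row_mx add_row_mx.
by congr row_mx; rewrite scale_scalar_mx -raddfD.
Qed.

Definition join : chain_map (cone (cm_zero X Y)) (stalk_at k ('rV[R]_(1 + b))).
Proof.
exists (fun i => mklin (@join_linear i)) => i j z /=.
by apply: stalk_eq; rewrite /= !raddf0 addr0 row_mx0.
Defined.

Lemma join_quasi_iso : quasi_iso join.
Proof.
apply/quasi_isoP => i; split=> [[y x] _ /stalk_coboundary /(congr1 (@cycle_val _ _ _ _))|y _].
  rewrite -[RHS](row_mx0 R 1 1 b) /= => /eq_row_mx[x0 y0].
  have -> : (y, x) = 0.
    congr (_, _); apply: stalk_eq; rewrite //=.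
    by have := congr1 (fun A : 'M_1 => A 0 0) x0; rewrite !mxE eqxx mulr1n.
  exact: coboundary0.
have p1 : cycle_pred (stalk_test k 'rV[R]_b i) (rsubmx (cycle_val y)).
  by apply/stalk_testP; case: (stalk_valP y) => [|->]; [left|right; rewrite raddf0].
have p2 : cycle_pred (stalk_test (k + 1) R^o (i + 1)) (lsubmx (cycle_val y) 0 0).
  by apply/stalk_testP; case: (stalk_valP y) => [e|->]; [left; congr (_ + 1)|right; rewrite !mxE].
exists (Cycle p1, Cycle p2).
  by apply/cone_cocycle; rewrite /= addr0.
apply/stalk_coboundary/stalk_eq; rewrite linearB /= -mx11_scalar hsubmxK; exact: subrr.
Qed.

End Join.

Lemma perfect_stalk_rV k b : perfect (stalk_at k ('rV[R]_b : lmodType R)).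
Proof.
have Tt := @perfect_thick R; elim: b k => [|b IHb] k.
  apply: (thick_iso Tt _ (thick_zero Tt)); apply: isomorphic_sym.
  apply: (@quasi_iso_isomorphic _ _ _ (cm_zero _ _)); apply/quasi_isoP => i.
  split=> [x _ _|y _].
    by rewrite (_ : x = 0); [exact: coboundary0|apply: stalk_eq; exact: rV0_eq0].
  by exists 0 => //; rewrite subr0 [y]rV0_eq0; exact: coboundary0.
apply: (thick_iso Tt (quasi_iso_isomorphic (join_quasi_iso k b))).
apply: (thick_cone Tt (cone_is_cone _)) => //; exact: perfect_stalk_R.
Qed.

End PerfectStalks.

(** * Submodules of free modules over a Noetherian ring *)

Section Noetherian.
Variables (R : comPzRingType) (noeth : noetherian R).

(** A vector is a function on nat of which only the first b entries matter, so
    that the induction on b takes place in one type. The last entries of the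
    vectors of S form an ideal; subtracting a combination of vectors that lift
    its generators makes the last entry of a vector vanish, and the vectors
    with this property are covered by induction. *)
Lemma noetherian_vectors b (S : (nat -> R) -> Prop) :
  S (fun=> 0) -> (forall v w, S v -> S w -> S (fun a => v a + w a)) ->
  (forall r v, S v -> S (fun a => r * v a)) ->
  exists n (g : nat -> nat -> R), (forall k, S (g k)) /\
    forall w, S w -> exists c : nat -> R,
      forall a, (a < b)%N -> w a = \sum_(k < n) c k * g k a.
Proof.
elim: b S => [|b IHb] S S0 SD SZ; first by exists 0%N, (fun _ _ => 0); split=> // w _; exists (fun=> 0).
have [|n [g gE]] := noeth (I := fun x => exists2 w, S w & w b = x).
  split=> [|x y [v Sv <-] [w Sw <-]|r x [v Sv <-]].
  - by exists (fun=> 0).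
  - by exists (fun a => v a + w a); first exact: SD.
  - by exists (fun a => r * v a); first exact: SZ.
have gS (k : 'I_n) : exists2 w, S w & w b = g k.
  change ((fun x => exists2 w, S w & w b = x) (g k)); rewrite gE.
  exists (fun l => (l == k)%:R); rewrite (bigD1 k) //= eqxx mul1r big1 ?addr0 // => l.
  by move=> /negPf ->; rewrite mul0r.
have [h hS hb] : exists2 h : 'I_n -> nat -> R, forall k, S (h k) & forall k, h k b = g k.
  have [h hP] := choice (fun k => let: ex_intro2 w a b := gS k in ex_intro _ w (conj a b)).
  by exists h => k; have [] := hP k.
have sumS (c : 'I_n -> R) : S (fun a => \sum_k c k * h k a).
  have -> : (fun a => \sum_k c k * h k a) = \sum_k (fun a => c k * h k a).
    by apply/funext => a; rewrite fct_sumE.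
  by elim/big_ind: _ => [|v w|k _]; [exact: S0|exact: SD|exact: SZ].
have [|v w [Sv v0] [Sw w0]|r v [Sv v0]|m [g' [g'S g'P]]] :=
    IHb (fun w => S w /\ w b = 0).
- by [].
- by split; [exact: SD|rewrite v0 w0 addr0].
- by split; [exact: SZ|rewrite v0 mulr0].
exists (n + m)%N.
(* The generators h of the last entries come first, then those of the vectors
   with vanishing last entry. *)
exists (fun k => if insub k is Some l then h l else g' (k - n)%N).
split=> [k|w Sw]; first by case: insubP => [l _ _|_]; [exact: hS|have [] := g'S (k - n)%N].
have [c cE] : exists c : 'I_n -> R, w b = \sum_(k < n) c k * g k.
  by change ([set x | exists c : 'I_n -> R, x = \sum_(k < n) c k * g k]%classic (w b));
    rewrite -gE; exists w.
have [|c' c'E] := g'P (fun a => w a + -1 * (\sum_k c k * h k a)).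
  split; first by apply: SD => //; exact: SZ.
  by rewrite cE mulN1r; under [X in _ - X]eq_bigr do rewrite hb; rewrite subrr.
exists (fun k => if insub k is Some l then c l else c' (k - n)%N) => a ab.
rewrite big_split_ord /=.
under eq_bigr => k _ do rewrite valK.
under [X in _ + X]eq_bigr => k _.
  rewrite insubF ?ltnNge ?leq_addr //= addKn; over.
have [->|ab'] := eqVneq a b.
  rewrite cE (eq_bigr (fun k => c k * h k b)) => [|k _]; last by rewrite hb.
  rewrite [X in _ + X]big1 ?addr0 // => k _.
  by have [_ ->] := g'S k; rewrite mulr0.
have <- : w a + -1 * (\sum_k c k * h k a) = \sum_(k < m) c' k * g' k a.
  by apply: c'E; lia.
by rewrite mulN1r addrC subrK.
Qed.

Lemma noetherian_rows b (S : 'rV[R]_b -> Prop) :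
  S 0 -> (forall v w, S v -> S w -> S (v + w)) ->
  (forall r v, S v -> S (r *: v)) ->
  exists n (g : 'I_n -> 'rV[R]_b), (forall k, S (g k)) /\
    forall w, S w -> exists c : 'I_n -> R, w = \sum_k c k *: g k.
Proof.
move=> S0 SD SZ.
pose row (w : nat -> R) : 'rV[R]_b := \row_a w a.
have [|v w Sv Sw|r v Sv|n [g [gS gP]]] :=
    @noetherian_vectors b (fun w => S (row w)).
- by rewrite (_ : row _ = 0) //; apply/rowP => a; rewrite !mxE.
- by rewrite (_ : row _ = row v + row w); [exact: SD|apply/rowP => a; rewrite !mxE].
- by rewrite (_ : row _ = r *: row v); [exact: SZ|apply/rowP => a; rewrite !mxE].
exists n, (fun k => row (g k)); split=> // w Sw.
pose w' a := if insub a is Some l then w 0 l else 0.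
have [|c cP] := gP w'.
  rewrite (_ : row _ = w) //; apply/rowP => a; rewrite !mxE /w' valK //.
exists c; apply/rowP => a; rewrite summxE; have := cP a (ltn_ord a).
by rewrite /w' valK => ->; apply: eq_bigr => k _; rewrite !mxE.
Qed.

End Noetherian.

Section FreeModule.
Variables (R : comPzRingType) (M : lmodType R) (n : nat) (g : 'I_n -> M).

Lemma lincomb_linear : linear (fun v : 'rV[R]_n => \sum_a v 0 a *: g a).
Proof.
move=> r v w; rewrite scaler_sumr -big_split; apply: eq_bigr => a _ /=.
by rewrite !mxE scalerDl scalerA.
Qed.

Definition lincomb := mklin lincomb_linear.

Lemma lincomb_row c : lincomb (\row_a c a) = \sum_a c a *: g a.
Proof. by apply: eq_bigr => a _; rewrite mxE. Qed.

End FreeModule.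

(** * Killing the top cohomology *)

Section Kill.
Variables (R : comPzRingType) (noeth : noetherian R).
Variables (X : complex R) (j : int) (n : nat) (g : 'I_n -> X (j + 1)).
Hypothesis g_cocycle : forall k, cocycle (g k).
Hypothesis g_gen :
  forall x, cocycle x -> exists c : 'I_n -> R, coboundary (x - \sum_k c k *: g k).
Hypothesis X_fg : forall i, coh_fg X i.

Lemma lincomb_cocycle v : cocycle (lincomb g v).
Proof. exact: cocycle_sum. Qed.

(** In its cone the cohomology of X in the top degree j + 1 is gone, and the
    relations between the classes of g appear in degree j. *)
Definition kill_map : chain_map (stalk_at (j + 1) ('rV[R]_n : lmodType R)) X :=
  stalk_map lincomb_cocycle.

Let Y := cone kill_map.

Lemma kill_other i (y : Y i) : i != j -> cocycle y ->
  exists2 x, cocycle x & y = cone_in kill_map i x.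
Proof.
case: y => y a ij /cone_cocycleP[].
have -> : a = 0 by apply: stalk_eq0; move=> /(addIr 1)/eqP; apply/negP.
by rewrite linear0 addr0 => y0 _; exists y.
Qed.

(** A combination of the g, viewed in the cone, is the boundary of its vector
    of coefficients. *)
Lemma kill_acyclic i :
  i != j -> acyclic_at X i \/ i = j + 1 -> acyclic_at Y i.
Proof.
move=> ij H y /(kill_other ij)[x x0 ->]; case: H x x0 => [Xi x x0|->{i ij y} x x0].
  exact/cm_coboundary/Xi.
have [c cE] := g_gen x0.
rewrite -[x](subrK (\sum_k c k *: g k)) linearD; apply: coboundaryD; first exact: cm_coboundary.
apply/cone_coboundary; exists 0, (stalk_el erefl (\row_k c k)).
by rewrite linear0 add0r stalk_mapE /= -lincomb_row oppr0.
Qed.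

(** Together with generators for X, finitely many cocycles h generate as soon
    as every cocycle of the cone comes from X modulo h. *)
Lemma coh_fg_cone i m (h : 'I_m -> Y i) : (forall l, cocycle (h l)) ->
  (forall y, cocycle y -> exists (c : 'I_m -> R) (x : X i),
    y - \sum_l c l *: h l = cone_in kill_map i x) ->
  coh_fg Y i.
Proof.
move=> h0 hP; have [p [f [f0 fP]]] := X_fg i.
exists (m + p)%N, (fun k => match fintype.split k with
  inl l => h l | inr l => cone_in kill_map i (f l) end).
split=> [k|y y0]; first by case: fintype.splitP => l _ //; exact: cm_cocycle.
have [c [x xE]] := hP y y0.
have x0 : cocycle x.
  have : cocycle (cone_in kill_map i x) by rewrite -xE; apply/cocycleD/cocycleN/cocycle_sum.
  by case/cone_cocycleP; rewrite linear0 addr0.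
have [d dE] := fP x x0.
exists (fun k => match fintype.split k with inl l => c l | inr l => d l end).
rewrite big_split_ord /= opprD addrA.
rewrite (eq_bigr (fun l => c l *: h l)) => [|l _]; last first.
  by have -> : fintype.split (lshift p l) = inl l := unsplitK (inl l).
rewrite [X in _ - X](eq_bigr (fun l => d l *: cone_in kill_map i (f l))) => [|l _]; last first.
  by have -> : fintype.split (rshift m l) = inr l := unsplitK (inr l).
rewrite xE (_ : _ - _ = cone_in kill_map i (x - \sum_l d l *: f l)); first exact: cm_coboundary.
by rewrite linearB [in RHS]linear_sum; under [in RHS]eq_bigr do rewrite linearZ.
Qed.

(** In degree j the cocycles of the cone map to the module of relations
    between the classes of g; it is a submodule of R^n, hence finitely
    generated. *)
Lemma kill_fg i : coh_fg Y i.
Proof.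
have [->|ij] := eqVneq i j; last first.
  apply: (@coh_fg_cone i 0 (fun=> 0)) => [[]//|y /(kill_other ij)[x _ ->]].
  by exists (fun=> 0), x; rewrite big_ord0 subr0.
have [||r v|m [v [vS vP]]] := @noetherian_rows R noeth n (fun v => coboundary (lincomb g v)).
- by rewrite linear0; exact: coboundary0.
- by move=> v w; rewrite linearD; exact: coboundaryD.
- by rewrite linearZ; exact: coboundaryZ.
have wE l : exists w : X j, cpx_diff X j (j + 1) w = - lincomb g (v l).
  exact/(coboundary_pred erefl)/coboundaryN/vS.
have [w wP] := choice wE.
apply: (@coh_fg_cone j m (fun l => (w l, stalk_el erefl (v l)))).
  by move=> l; apply/cone_cocycleP; split; rewrite ?stalk_mapE //= wP addNr.
move=> [x a] /cone_cocycleP[xa _].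
have [|c cE] := vP (cycle_val a).
  have aE : kill_map (j + 1) a = lincomb g (cycle_val a) := stalk_mapE _ a.
  rewrite -aE -[kill_map _ _]opprK; apply: coboundaryN; exists j, x.
  by apply/eqP; rewrite -addr_eq0 xa.
exists c, (x - \sum_l c l *: w l).
have -> : \sum_l c l *: ((w l, stalk_el erefl (v l)) : Y j) =
    (\sum_l c l *: w l, a) :> Y j.
  rewrite [LHS]surjective_pairing !raddf_sum /=; congr (_, _).
  by apply: stalk_eq; rewrite raddf_sum cE.
by congr (_, _); rewrite /= subrr.
Qed.

End Kill.

(** * Truncation *)

Section Truncation.
Variables (R : comPzRingType) (X : complex R) (k : int).

(** The truncation in degrees at most k is cut out as a kernel: nothing is
    imposed below k, being a cocycle in degree k, and being 0 above. *)
Lemma trunc_test_linear i : linear (fun x : X i =>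
  (if k < i then x else 0, if k <= i then cpx_diff X i (i + 1) x else 0)
  : (X i * X (i + 1)%R)%type).
Proof.
move=> r x y; congr (_, _) => /=; first by case: ifP; rewrite ?scaler0 ?addr0.
by case: ifP; rewrite ?linearP ?scaler0 ?addr0.
Qed.

Definition trunc_test i := mklin (@trunc_test_linear i).

Lemma trunc_testP i (x : X i) : cycle_pred (trunc_test i) x <->
  (k < i -> x = 0) /\ (k <= i -> cocycle x).
Proof.
rewrite /cycle_pred; split=> [/eqP[A B]|[A B]].
  by split=> H; move: A B; rewrite H.
by apply/eqP; congr (_, _); [case: ifP => // H; exact: A|case: ifP => // H; exact: B].
Qed.

Lemma trunc_valP i (z : cycles (trunc_test i)) :
  (k < i -> cycle_val z = 0) /\ (k <= i -> cocycle (cycle_val z)).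
Proof. exact/trunc_testP/cycleP. Qed.

Lemma trunc_diff_proof i j (z : cycles (trunc_test i)) :
  cycle_pred (trunc_test j) (cpx_diff X i j (cycle_val z)).
Proof.
have [_ zc] := trunc_valP z.
apply/trunc_testP; split=> [kj|_]; last by rewrite /cocycle cpx_sq.
have [ij|ij] := eqVneq (i + 1) j; last by rewrite cpx_shape.
by apply: cocycle_all; apply: zc; lia.
Qed.

Lemma trunc_diff_linear i j :
  linear (fun z : cycles (trunc_test i) => Cycle (trunc_diff_proof j z)).
Proof. by move=> r y z; apply: val_inj; rewrite /= linearP. Qed.

Definition trunc : complex R.
Proof.
exists (fun i => cycles (trunc_test i)) (fun i j => mklin (@trunc_diff_linear i j)).
- by move=> i j z ij; apply: val_inj; rewrite /= cpx_shape.
- by move=> i j l z; apply: val_inj; rewrite /= cpx_sq.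
Defined.

Definition trunc_incl : chain_map trunc X.
Proof. by exists (fun i => mklin (@cycle_val_linear R _ _ (trunc_test i))). Defined.

Lemma trunc_cocycle i (z : trunc i) : cocycle z <-> cocycle (cycle_val z).
Proof.
rewrite /cocycle; split=> [/(congr1 (@cycle_val _ _ _ _))//|z0].
exact: val_inj.
Qed.

Lemma trunc_coboundary i (z : trunc i) : i <= k -> coboundary (cycle_val z) -> coboundary z.
Proof.
move=> ik /(coboundary_pred (subrK 1 i))[w wz].
have p : cycle_pred (trunc_test (i - 1)) w.
  by apply/trunc_testP; split=> H; exfalso; lia.
by exists (i - 1), (Cycle p); apply: val_inj.
Qed.

Lemma trunc_gt i (z : trunc i) : k < i -> z = 0.
Proof. by move=> ki; apply: val_inj; exact: (proj1 (trunc_valP z) ki). Qed.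

Hypothesis X_conc : forall i, i != k -> acyclic_at X i.

Lemma trunc_incl_quasi_iso : quasi_iso trunc_incl.
Proof.
apply/quasi_isoP => i; have [ki|ik] := ltP k i; split=> [x x0|y y0].
- by rewrite (trunc_gt x) // => _; exact: coboundary0.
- exists 0; first exact: cocycle0.
  by rewrite (linear0 (trunc_incl i)) subr0; apply: X_conc => //; rewrite gt_eqF.
- exact: trunc_coboundary.
- have p : cycle_pred (trunc_test i) y by apply/trunc_testP; split=> // H; lia.
  by exists (Cycle p); [exact/trunc_cocycle|rewrite /= subrr; exact: coboundary0].
Qed.

Let M := cohomology X k.

Lemma trunc_top_proof i (z : trunc i) :
  cycle_pred (cpx_diff X k (k + 1)) (degree_cast k (cycle_val z)).
Proof.
apply: cocycle_pred; have [ik|ik] := eqVneq i k; last first.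
  by rewrite degree_cast_neq //; exact: cocycle0.
have zc : cocycle (cycle_val z) by apply: (proj2 (trunc_valP z)); rewrite ik.
by move: (cycle_val z) zc; case: _ / ik => x; rewrite degree_castK.
Qed.

Lemma trunc_top_linear i : linear (fun z : trunc i =>
  homology_class (cpx_diff X (k - 1) k) (Cycle (trunc_top_proof z)) : M).
Proof.
move=> r y z; rewrite -linearP; congr homology_class; apply: val_inj => /=.
by rewrite -!linearP.
Qed.

Definition trunc_top i := mklin (@trunc_top_linear i).

Lemma trunc_top_eq0 i (z : trunc i) : trunc_top i z = 0 <-> coboundary (degree_cast k (cycle_val z)).
Proof.
have c0 : cocycle (degree_cast k (cycle_val z)) by apply/eqP; exact: trunc_top_proof.
rewrite -(coh_class0 c0) /coh_class /=.
by rewrite (_ : Cycle _ = Cycle (cocycle_pred c0)) //; exact: val_inj.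
Qed.

Lemma trunc_proj_proof i (z : trunc i) :
  cycle_pred (stalk_test k M i) (trunc_top i z).
Proof.
apply/stalk_testP; have [ik|ik] := eqVneq i k; [by left|right].
by apply/trunc_top_eq0; rewrite degree_cast_neq //; exact: coboundary0.
Qed.

Lemma trunc_proj_linear i :
  linear (fun z : trunc i => Cycle (trunc_proj_proof z) : stalk_at k M i).
Proof. by move=> r y z; apply: stalk_eq; exact: (linearP (trunc_top i)). Qed.

Definition trunc_proj : chain_map trunc (stalk_at k M).
Proof.
exists (fun i => mklin (@trunc_proj_linear i)) => i j z.
apply: stalk_eq; apply/trunc_top_eq0; have [jk|jk] := eqVneq j k.
  by exists i, (cycle_val z); rewrite /= degree_cast_diff.
by rewrite degree_cast_neq //; exact: coboundary0.
Defined.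

(** When k is the only degree with cohomology, the truncation links X to the
    stalk complex of its cohomology module. *)
Lemma trunc_proj_quasi_iso : quasi_iso trunc_proj.
Proof.
apply/quasi_isoP => i; have [ki|ik] := ltP k i; split=> [x x0|y _].
- by rewrite (trunc_gt x) // => _; exact: coboundary0.
- exists 0; first exact: cocycle0.
  rewrite (linear0 (trunc_proj i)) subr0 (stalk_eq0 y); first exact: coboundary0.
  by move=> ik; rewrite ik ltxx in ki.
- move=> /stalk_coboundary/(congr1 (@cycle_val _ _ _ _))/trunc_top_eq0 xb.
  apply: trunc_coboundary ik _; have [ik|ik] := eqVneq i k; last exact/X_conc/trunc_cocycle.
  exact/(degree_cast_coboundary _ ik).
- have [e|/eqP e] := eqVneq i k; last first.
    exists 0; first exact: cocycle0.
    by rewrite (linear0 (trunc_proj i)) subr0 (stalk_eq0 y e); exact: coboundary0.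
  (* A representative in degree k is transported to the equal degree i. *)
  have [x [x0 xE]] := coh_class_onto (cycle_val y).
  have [w [wc wE]] : exists w : X i, cocycle w /\ degree_cast k w = x.
    exists (degree_cast i x); rewrite degree_castKK //; split=> //.
    have [//|] := eqVneq k i; last by rewrite e eqxx.
    by move=> ki; move: x x0 {xE} => x x0; case: _ / ki; rewrite degree_castK.
  have p : cycle_pred (trunc_test i) w.
    by apply/trunc_testP; split=> // H; rewrite e ltxx in H.
  exists (Cycle p); first exact/trunc_cocycle.
  have <- : y = trunc_proj i (Cycle p); last by rewrite subrr; exact: coboundary0.
  by apply: stalk_eq; rewrite xE; congr homology_class; apply: val_inj; rewrite /= wE.
Qed.

End Truncation.

(** * Free resolutions by matrices *)

Section MatrixSequences.
Variable R : comPzRingType.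

(** Matrices are read off functions on nat, and their sizes are given only
    where they are used; ranks that vary with the degree then cause no type
    mismatch. *)
Definition mx m n (A : nat -> nat -> R) : 'M[R]_(m, n) := \matrix_(a, c) A a c.

Lemma mx_onto m n (B : 'M[R]_(m, n)) : exists A, B = mx m n A.
Proof.
exists (fun a c => if (insub a, insub c) is (Some a', Some c') then B a' c' else 0).
by apply/matrixP => a c; rewrite mxE !valK.
Qed.

Lemma tr_mx m n A : (mx m n A)^T = mx n m (fun a c => A c a).
Proof. by apply/matrixP => a c; rewrite !mxE. Qed.

Hypothesis noeth : noetherian R.

(** Exactness at the middle of the R-dual of the sequence of row vectors R^m
    -> R^b -> R^b', v |-> v A, v |-> v A'. *)
Definition dual_exact m b b' (A A' : nat -> nat -> R) :=
  mx m b A *m mx b b' A' = 0 /\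
  forall w : 'cV_b, mx m b A *m w = 0 -> exists w', w = mx b b' A' *m w'.

Lemma dual_exact_next (s : nat * nat * (nat -> nat -> R)) :
  exists t : nat * (nat -> nat -> R), dual_exact s.1.1 s.1.2 t.1 s.2 t.2.
Proof.
case: s => [[m b] A] /=.
have [||r v v0|n [g [gS gP]]] :=
    noetherian_rows noeth (S := fun v : 'rV_b => mx m b A *m v^T = 0).
- by rewrite trmx0 mulmx0.
- by move=> v w v0 w0; rewrite linearD mulmxDr v0 w0 addr0.
- by rewrite linearZ -scalemxAr v0 scaler0.
have [A' A'E] := mx_onto (\matrix_(a < b, e < n) g e 0 a).
exists (n, A'); split; rewrite -A'E /=.
  apply/matrixP => a e; rewrite !mxE.
  transitivity ((mx m b A *m (g e)^T) a 0); last by rewrite gS mxE.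
  by rewrite !mxE; apply: eq_bigr => c _; rewrite !mxE.
move=> w w0; have [|c cE] := gP w^T; first by rewrite trmxK.
exists (\col_e c e); apply/colP => a; have := congr1 (fun v : 'rV_b => v 0 a) cE.
rewrite !mxE summxE => ->; apply: eq_bigr => e _.
by rewrite !mxE mulrC.
Qed.

(** A resolution of the cokernel of the transpose of A by free modules of
    finite rank, dualized. *)
Lemma dual_exact_sequence m b (A : nat -> nat -> R) :
  exists (B : nat -> nat) (E : nat -> nat -> nat -> R),
    [/\ B 0%N = m, B 1%N = b, E 0%N = A &
      forall k, dual_exact (B k) (B k.+1) (B k.+2) (E k) (E k.+1)].
Proof.
have [nx nxP] := choice dual_exact_next.
pose st k := iter k (fun s => (s.1.2, (nx s).1, (nx s).2)) (m, b, A).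
exists (fun k => (st k).1.1), (fun k => (st k).2); by split=> // k; exact: nxP (st k).
Qed.

(** Exactness on rows is dual exactness of the transposed matrices, so the
    sequence that starts from the transposed matrix of relations of M provides
    the resolution. *)
Lemma free_resolution (M : lmodType R) : fin_gen M ->
  exists (p : nat -> nat) (d : nat -> nat -> nat -> R) (aug : {linear 'rV[R]_(p 0%N) -> M}),
  [/\ forall m, exists v, aug v = m,
      forall v, aug v = 0 <-> exists w : 'rV_(p 1%N), w *m mx (p 1%N) (p 0%N) (d 0%N) = v &
      forall k (v : 'rV_(p k.+1)), v *m mx (p k.+1) (p k) (d k) = 0 <->
        exists w : 'rV_(p k.+2), w *m mx (p k.+2) (p k.+1) (d k.+1) = v].
Proof.
move=> [n [g gP]].
have [||r v v0|m [h [hS hP]]] :=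
    noetherian_rows noeth (S := fun v => lincomb g v = 0).
- exact: linear0.
- by move=> v w v0 w0; rewrite linearD v0 w0 addr0.
- by rewrite linearZ v0; exact: scaler0.
have [A AE] := mx_onto (\matrix_(c < n, a < m) h a 0 c).
have [B [E [B0 B1 E0 BE]]] := dual_exact_sequence n m A.
move: g gP h hS hP A AE E0; rewrite -{}B0 -{}B1 => g gP h hS hP A AE E0.
exists B, (fun k a c => E k c a), (lincomb g); split=> [x|v|k v].
- by have [c ->] := gP x; exists (\row_a c a); rewrite lincomb_row.
- rewrite -tr_mx E0 -AE; split=> [/hP[c ->]|[w <-]].
    exists (\row_a c a); apply/rowP => a; rewrite !mxE summxE.
    by apply: eq_bigr => e _; rewrite !mxE.
  have -> : w *m (\matrix_(c, a) h a 0 c)^T = \sum_a w 0 a *: h a.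
    apply/rowP => a; rewrite !mxE summxE; apply: eq_bigr => e _.
    by rewrite !mxE.
  by rewrite linear_sum big1 // => a _; rewrite linearZ hS; exact: scaler0.
- have [EE Ex] := BE k; rewrite -(tr_mx _ _ (E k)) -(tr_mx _ _ (E k.+1)); split=> [v0|[w <-]].
    have [|w wE] := Ex v^T; first by rewrite -[mx _ _ _]trmxK -trmx_mul v0 trmx0.
    by exists w^T; rewrite -trmx_mul -wE trmxK.
  by rewrite -mulmxA -trmx_mul EE trmx0 mulmx0.
Qed.

Lemma rV_projective b : projective ('rV[R]_b : lmodType R).
Proof.
move=> U V p f ps.
have [g gP] := choice (fun a : 'I_b => ps (f (delta_mx 0 a))).
exists (lincomb g) => x; rewrite linear_sum [x in RHS]row_sum_delta linear_sum.
by apply: eq_bigr => a _; rewrite !linearZ /= gP.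
Qed.

Lemma free_resolution_exists (M : lmodType R) :
  fin_gen M -> inhabited (resolution M).
Proof.
move=> /free_resolution[p [d [aug [aS e0 e]]]].
by exists; exact: (@Resolution R M (fun n => 'rV[R]_(p n))
  (fun n => mulmxr (mx (p n.+1) (p n) (d n))) aug
  (fun n => @rV_projective (p n)) aS e0 e).
Qed.

End MatrixSequences.

(** * Cohomology annihilators act as zero *)

Section Splice.
Variables (R : comPzRingType) (M : lmodType R) (b : nat).
Variables (p : {linear 'rV[R]_b -> M}) (p_surj : forall m, exists v, p v = m).

Definition splice_mod (P : nat -> lmodType R) n : lmodType R :=
  match n with 0 => 'rV[R]_b | n.+1 => P n end.

Variable P : resolution (cycles p).

Definition splice_diff n : {linear splice_mod P n.+1 -> splice_mod P n} :=
  match n with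
  | 0 => mklin (@cycle_val_linear _ _ _ p) \o res_aug P
  | n.+1 => res_diff P n
  end.

(** Dimension shifting holds by definition: for i > 0, Ext^(i+1) computed from
    this resolution of M is Ext^i of the syzygy computed from P. *)
Definition splice : resolution M.
Proof.
exists (splice_mod P) splice_diff p => //.
- by case=> [|n]; [exact: rV_projective|exact: res_projective].
- move=> x; split=> [/eqP x0|[y <-]]; last exact/eqP/cycleP.
  have [y yE] := res_aug_surj P (Cycle x0).
  by exists y; rewrite /= yE.
- case=> [|n] x; last exact: res_exact.
  rewrite -res_exact0; split=> [x0|/= -> //]; exact: val_inj.
Defined.

Section StalkStep.
Variable k : int.
Let u := stalk_fun (k + 1) p.

Lemma syzygy_in_linear : linear (fun z : cycles p =>
  (0, stalk_el erefl (cycle_val z)) : cone u k).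
Proof.
move=> r y z; congr (_, _); first by rewrite /= scaler0 addr0.
exact: stalk_eq.
Qed.

Lemma syzygy_in_cocycle z : cocycle (mklin syzygy_in_linear z).
Proof.
apply/cone_cocycleP; rewrite linear0 add0r; split=> //.
by apply: stalk_eq; have /eqP := cycleP z.
Qed.

Definition syzygy_in : chain_map (stalk_at k (cycles p)) (cone u) :=
  stalk_map syzygy_in_cocycle.

(** The cone of R^b -> M is the syzygy placed one degree lower, by the exact
    sequence 0 -> K -> R^b -> M -> 0. *)
Lemma syzygy_in_quasi_iso : quasi_iso syzygy_in.
Proof.
apply/quasi_isoP => i; have [ik|/eqP ik] := eqVneq i k; last first.
  split=> [x _ _|]; first by rewrite (stalk_eq0 x ik); exact: coboundary0.
  move=> [m x] _; exists 0; first exact: cocycle0.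
  rewrite (linear0 (syzygy_in i)) subr0.
  have -> : x = 0 by apply: stalk_eq0 => /addIr.
  move: i ik m {x}; apply: int_succ => i ik m.
  have [e|/eqP e] := eqVneq (i + 1) (k + 1); last first.
    by rewrite (stalk_eq0 m e); exact: coboundary0.
  have [v vE] := p_surj (cycle_val m).
  apply/cone_coboundary; exists 0, (stalk_el e v); split; last by rewrite oppr0.
  by rewrite linear0 add0r; apply: stalk_eq.
subst i.
have E (z : stalk_at k (cycles p) k) :
  syzygy_in k z = (0, stalk_el erefl (cycle_val (cycle_val z))) := stalk_mapE _ z.
split=> [x _|[m x]].
  rewrite E => -[j [[w v]]] /(congr1 (fun y => cycle_val y.2)) /=.
  rewrite oppr0 => x0; apply/stalk_coboundary; apply: stalk_eq; exact: val_inj.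
move=> /cone_cocycleP[]; rewrite (stalk_eq0 m) => [|e]; last by lia.
rewrite linear0 add0r => /(congr1 (@cycle_val _ _ _ _)) /= /eqP x0 _.
exists (stalk_el erefl (Cycle x0)) => //. rewrite degree_castK.
rewrite (_ : _ - _ = 0); first exact: coboundary0.
by apply/eqP; rewrite subr_eq0; apply/eqP; congr (_, _); exact: stalk_eq.
Qed.

End StalkStep.
End Splice.

Lemma sub_swap (V : zmodType) (x y z t : V) : x - y = z - t -> z - x = t - y.
Proof.
move=> E; rewrite -[z](subrK t) -E addrAC [x - y - x]addrAC subrr add0r.
exact: addrC.
Qed.

Section QuasiIsoInvariance.
Variables (R : comPzRingType) (X Y : complex R) (f : chain_map X Y).
Hypothesis fq : quasi_iso f.

Lemma quasi_iso_acyclic i : acyclic_at X i <-> acyclic_at Y i.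
Proof.
have [inj surj] := (quasi_isoP f).1 fq i; split=> H x x0; last exact/inj/H/cm_cocycle.
have [y y0 /coboundaryD] := surj x x0; move=> /(_ _ (cm_coboundary f (H y y0))).
by rewrite subrK.
Qed.

Lemma quasi_iso_coh_fg i : coh_fg X i <-> coh_fg Y i.
Proof.
have [inj surj] := (quasi_isoP f).1 fq i; split=> -[n [g [g0 gP]]].
  exists n, (fun k => f i (g k)); split=> [k|y /surj[x x0 yx]]; first exact: cm_cocycle.
  have [c cE] := gP x x0; exists c; have := coboundaryD yx (cm_coboundary f cE).
  rewrite linearB addrA subrK linear_sum.
  by under eq_bigr do rewrite linearZ.
have hx k : exists x : X i, cocycle x /\ coboundary (g k - f i x).
  by have [x x0 gx] := surj (g k) (g0 k); exists x.
have [h hP] := choice hx.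
exists n, h; split=> [k|x x0]; first by have [] := hP k.
have [c cE] := gP _ (cm_cocycle f x0); exists c; apply: inj.
  by apply/cocycleD/cocycleN/cocycle_sum => // k; have [] := hP k.
have -> : f i (x - \sum_k c k *: h k) =
    (f i x - \sum_k c k *: g k) + \sum_k c k *: (g k - f i (h k)).
  under [X in _ = _ + X]eq_bigr do rewrite scalerBr.
  rewrite sumrB addrA subrK linearB linear_sum.
  by under [in LHS]eq_bigr do rewrite linearZ.
apply: coboundaryD => //; elim/big_ind: _ => [|y z|k _]; [exact: coboundary0|exact: coboundaryD|].
by apply: coboundaryZ; have [] := hP k.
Qed.

Lemma quasi_iso_Df : total_cohomology_fin_gen X <-> total_cohomology_fin_gen Y.
Proof.
split=> /total_cohomology_fin_genP[[N XN] Xfg]; apply/total_cohomology_fin_genP.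
  split=> [|i]; last exact/quasi_iso_coh_fg.
  by exists N => i /XN/quasi_iso_acyclic.
split=> [|i]; last exact/quasi_iso_coh_fg.
by exists N => i /XN/quasi_iso_acyclic.
Qed.

End QuasiIsoInvariance.

Section CaToAnn.
Variables (R : comPzRingType) (noeth : noetherian R).

Lemma fin_gen_rV b : fin_gen ('rV[R]_b : lmodType R).
Proof.
exists b, (fun a => delta_mx 0 a) => x; exists (fun a => x 0 a).
exact: row_sum_delta.
Qed.

Lemma fin_gen_kernel b (M : lmodType R) (p : {linear 'rV[R]_b -> M}) :
  fin_gen (cycles p).
Proof.
have [||r v v0|n [g [g0 gP]]] := noetherian_rows noeth (S := fun v => p v = 0).
- exact: linear0.
- by move=> v w v0 w0; rewrite linearD v0 w0 addr0.
- by rewrite linearZ v0; exact: scaler0.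
have gc k : cycle_pred p (g k) by apply/eqP.
exists n, (fun k => Cycle (gc k)) => x.
have [|c cE] := gP (cycle_val x); first exact/eqP/cycleP.
by exists c; apply: val_inj; rewrite raddf_sum /= cE.
Qed.

Lemma fin_gen_onto (M : lmodType R) : fin_gen M ->
  exists b (p : {linear 'rV[R]_b -> M}), forall m, exists v, p v = m.
Proof.
move=> [b [g gP]]; exists b, (lincomb g) => m; have [c ->] := gP m.
by exists (\row_a c a); rewrite lincomb_row.
Qed.

Lemma ca_at_le (M : lmodType R) m n r :
  (m <= n)%N -> ca_at m M r -> ca_at n M r.
Proof. by move=> mn H P N Nfg i ni; apply: H => //; exact: leq_trans ni. Qed.

Lemma ca_at_syzygy (M : lmodType R) b (p : {linear 'rV[R]_b -> M}) n r :
  (forall m, exists v, p v = m) ->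
  ca_at n.+2 M r -> ca_at n.+1 (cycles p) r.
Proof.
move=> pS H P N Nfg [//|i] ni x; exact: (H (splice pS P) N Nfg i.+2 ni x).
Qed.

(** The augmentation P_0 -> K represents the class of the extension 0 -> K ->
    R^b -> M -> 0 in Ext^1(M, K). As r kills it, multiplication by r on K
    extends to f : R^b -> K. Then r - f vanishes on K and descends to a map s
    from M to R^b, which lifts multiplication by r on M. *)
Lemma ca_at1_factor (M : lmodType R) b (p : {linear 'rV[R]_b -> M}) r :
  (forall m, exists v, p v = m) -> ca_at 1 M r ->
  exists s : {linear M -> 'rV[R]_b}, forall m, p (s m) = r *: m.
Proof.
move=> pS H; have Kfg := fin_gen_kernel p.
have [P] := free_resolution_exists noeth Kfg.
pose S := splice pS P.
pose z : Hom (S 1%N) (cycles p) := res_aug P.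
have z0 : cycle_pred (ext_diff S (cycles p) 2) z.
  apply/eqP/HomP => x; rewrite /Hom_fun /=.
  by apply/res_exact0; exists x.
(* f is the extension of r : K -> K that bounds r z. *)
have := H S (cycles p) Kfg 1%N isT (homology_class _ (Cycle z0)).
rewrite -linearZ => /eqP; rewrite -(linear0 (@homology_class _ _ _ _ _ _)).
move=> /eqP/homology_class_eq[f]; rewrite /= subr0 => fE.
have {}fE y : f (cycle_val (res_aug P y)) = r *: res_aug P y.
  exact: (congr1 (fun h : Hom (S 1%N) (cycles p) => Hom_fun h y) fE).
have [sec secK] := choice pS.
pose s m := r *: sec m - cycle_val (Hom_fun f (sec m)).
have sE v : s (p v) = r *: v - cycle_val (Hom_fun f v).
  have w0 : cycle_pred p (sec (p v) - v) by apply/eqP; rewrite linearB secK subrr.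
  have [y yE] := res_aug_surj P (Cycle w0).
  have := congr1 (@cycle_val _ _ _ _) (fE y); rewrite yE [in RHS]linearZ /=.
  by rewrite linearB [in LHS]linearB scalerBr /s => /sub_swap.
have tl : linear (fun v : 'rV[R]_b => r *: v - cycle_val (Hom_fun f v)).
  move=> a v w; rewrite (linearP (Hom_fun f)) (linearP (@cycle_val _ _ _ p)).
  by rewrite scalerDr scalerA mulrC -scalerA opprD addrACA scalerBr.
have sl : linear s.
  move=> a m m'; rewrite -{1}[m]secK -{1}[m']secK -linearP sE; exact: tl.
exists (mklin sl) => m.
rewrite /= /s linearB linearZ /= secK.
by have /eqP -> := cycleP (Hom_fun f (sec m)); rewrite subr0.
Qed.

Definition stalk_Dsg k (M : lmodType R) (Mfg : fin_gen M) : Dsg R :=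
  exist _ (stalk_at k M) (stalk_Df k Mfg).

(** In the singularity category M and its syzygy agree up to a shift, while
    passing to the syzygy lowers the degree from which r kills Ext. When that
    degree is 1, multiplication by r factors through a free module. *)
Lemma acts_as_zero_stalk n r (M : lmodType R) (Mfg : fin_gen M) k :
  ca_at n.+1 M r -> acts_as_zero r (stalk_Dsg k Mfg).
Proof.
elim: n M Mfg k => [|n IHn] M Mfg k H; have [b [p pS]] := fin_gen_onto Mfg.
  have [s sP] := ca_at1_factor pS H.
  apply: (@acts_as_zero_factor R r (stalk_Dsg k Mfg) (stalk_Dsg k (fin_gen_rV b)) (stalk_fun k p) (stalk_fun k s)).
    exact: perfect_stalk_rV.
  by move=> i x; apply: stalk_eq; rewrite /= sP.
pose j := k - 1; have jk : j + 1 = k by rewrite subrK.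
case: _ / jk.
have Kfg := fin_gen_kernel p.
pose u := stalk_fun (j + 1) p.
have Cfg : total_cohomology_fin_gen (cone u).
  exact/(quasi_iso_Df (syzygy_in_quasi_iso pS j))/stalk_Df.
pose C : Dsg R := exist _ (cone u) Cfg.
apply/(@acts_as_zero_iso R r (stalk_Dsg (j + 1) Mfg) C (cone_in u)).
  apply: in_Dsg_perfect_cone; apply: perfect_cone_in; exact: perfect_stalk_rV.
apply/(@acts_as_zero_iso R r (stalk_Dsg j Kfg) C (syzygy_in p j)).
  exact/in_Dsg_quasi_iso/syzygy_in_quasi_iso.
exact/IHn/ca_at_syzygy.
Qed.

Lemma fin_gen_cohomology (X : complex R) i : coh_fg X i -> fin_gen (cohomology X i).
Proof.
move=> [n [g [g0 gP]]]; exists n, (fun k => coh_class (g0 k)) => x.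
have [y [y0 ->]] := coh_class_onto x; have [c cE] := gP y y0.
by exists c; apply/coh_class_sum.
Qed.

(** The zigzag from X to a stalk complex through the truncation consists of
    quasi-isomorphisms. *)
Lemma acts_as_zero_concentrated r (X : Dsg R) k : ca_mod R r ->
  (forall i, i != k -> acyclic_at (sval X) i) -> acts_as_zero r X.
Proof.
move=> rca Xk; have [_ /(_ k)/fin_gen_cohomology Mfg] :=
  (total_cohomology_fin_genP (sval X)).1 (svalP X).
have Tfg : total_cohomology_fin_gen (trunc (sval X) k).
  exact/(quasi_iso_Df (trunc_incl_quasi_iso Xk))/svalP.
apply/(@acts_as_zero_iso R r (exist _ _ Tfg) X (trunc_incl (sval X) k)).
  exact/in_Dsg_quasi_iso/trunc_incl_quasi_iso.
apply/(@acts_as_zero_iso R r (exist _ _ Tfg) (stalk_Dsg k Mfg) (trunc_proj (sval X) k)).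
  exact/in_Dsg_quasi_iso/trunc_proj_quasi_iso.
have [n _ rn] := rca _ Mfg; apply: (@acts_as_zero_stalk n).
exact: ca_at_le rn.
Qed.

(** Killing the top cohomology does not change X in the singularity category
    and shortens the interval of degrees with cohomology from above; this is
    repeated until a single degree is left. *)
Lemma acts_as_zero_ca_mod r (X : Dsg R) : ca_mod R r -> acts_as_zero r X.
Proof.
move=> rca; have [[N XN] _] := (total_cohomology_fin_genP (sval X)).1 (svalP X).
have : forall i : int, - N%:Z - 1 <= i <= - N%:Z - 1 + N.*2.+2%:Z \/ acyclic_at (sval X) i.
  by move=> i; case: (ltnP N `|i|) => [/XN|iN]; [right|left; lia].
(* Induction on the length n of an interval that starts in degree a and
   contains all the cohomology. *)
move: (- N%:Z - 1) N.*2.+2 => a n.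
elim: n X {N XN} => [|n IHn] X Xa.
  by apply: (@acts_as_zero_concentrated r X a) => // i ia; case: (Xa i) => //; lia.
have [[N XN] Xfg] := (total_cohomology_fin_genP (sval X)).1 (svalP X).
pose j := a + n%:Z; have [m [g [g0 gP]]] := Xfg (j + 1).
pose u := kill_map g0.
have acy i : i != j -> acyclic_at (sval X) i \/ i = j + 1 -> acyclic_at (cone u) i.
  by move=> ij H; exact: kill_acyclic.
have Cfg : total_cohomology_fin_gen (cone u).
  apply/total_cohomology_fin_genP; split=> [|i]; last exact: kill_fg.
  exists (N + `|j|)%N => i iN; apply: acy; first by apply/eqP; lia.
  by left; apply: XN; lia.
apply/(@acts_as_zero_iso R r X (exist _ _ Cfg) (cone_in u)).
  apply: in_Dsg_perfect_cone; apply: perfect_cone_in; exact: perfect_stalk_rV.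
apply: IHn => i /=; have [->|ij] := eqVneq i j; first by left; rewrite /j; lia.
case: (Xa i) => [ia|Xi]; last by right; apply: acy => //; left.
have [e|/eqP e] := eqVneq i (j + 1); first by right; apply: acy => //; right.
by left; rewrite /j in ij e; move/eqP: ij; lia.
Qed.

End CaToAnn.

(** * Chain maps from bounded complexes of free modules *)

Section LinearCombinations.
Variables (R : comPzRingType) (V : lmodType R).
Implicit Types (A : nat -> R) (x : nat -> V).

Definition lcomb n A x := \sum_(c < n) A c *: x c.

Lemma eq_lcomb n A x y : (forall c, (c < n)%N -> x c = y c) -> lcomb n A x = lcomb n A y.
Proof. by move=> xy; apply: eq_bigr => c _; rewrite xy. Qed.

Lemma lcombD n A x y : lcomb n A (fun c => x c + y c) = lcomb n A x + lcomb n A y.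
Proof. by rewrite -big_split; apply: eq_bigr => c _; rewrite scalerDr. Qed.

Lemma lcombN n A x : lcomb n A (fun c => - x c) = - lcomb n A x.
Proof. by rewrite -sumrN; apply: eq_bigr => c _; rewrite scalerN. Qed.

Lemma lcombB n A x y : lcomb n A (fun c => x c - y c) = lcomb n A x - lcomb n A y.
Proof. by rewrite lcombD lcombN. Qed.

Lemma lcombZ n A x r : lcomb n A (fun c => r *: x c) = r *: lcomb n A x.
Proof. by rewrite scaler_sumr; apply: eq_bigr => c _; rewrite !scalerA mulrC. Qed.

Lemma lcombZl n A x r : lcomb n (fun c => r * A c) x = r *: lcomb n A x.
Proof. by rewrite scaler_sumr; apply: eq_bigr => c _; rewrite scalerA. Qed.

Lemma lcomb0 n A : lcomb n A (fun=> 0) = 0.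
Proof. by apply: big1 => c _; rewrite scaler0. Qed.

Lemma lcomb_lcomb n m A (B : nat -> nat -> R) x :
  lcomb n A (fun c => lcomb m (B c) x) = lcomb m (fun e => \sum_(c < n) A c * B c e) x.
Proof.
rewrite /lcomb; under eq_bigr do rewrite scaler_sumr.
rewrite exchange_big; apply: eq_bigr => e _; rewrite scaler_suml.
by apply: eq_bigr => c _; rewrite scalerA.
Qed.

Lemma lcomb_eq0 n A x : (forall c, (c < n)%N -> A c = 0) -> lcomb n A x = 0.
Proof. by move=> A0; apply: big1 => c _; rewrite A0 // scale0r. Qed.

End LinearCombinations.

Lemma linear_lcomb (R : comPzRingType) (U V : lmodType R) (f : {linear U -> V}) n A x :
  f (lcomb n A x) = lcomb n A (fun c => f (x c)).
Proof. by rewrite linear_sum; apply: eq_bigr => c _; rewrite linearZ. Qed.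

(** Families indexed by the degrees i + k are families indexed by all degrees.
    *)
Lemma reindex_family (T : int -> Type) k (f : forall i, T (i + k)) :
  exists f' : forall j, T j, forall i, f' (i + k) = f i.
Proof.
exists (fun j => ecast l (T l) (subrK k j) (f (j - k))) => i.
move: (subrK k (i + k)) (addrK k i); move: (i + k - k) => l e li.
by case: _ / (esym li) e => e; rewrite eq_axiomK.
Qed.

Lemma reindex_fam (R : comPzRingType) (X : complex R) k
    (f : forall i, nat -> X (i + k)) :
  exists f' : forall j, nat -> X j, forall i, f' (i + k) = f i.
Proof. exact: (@reindex_family (fun i => nat -> X i)). Qed.

Section Families.
Variable R : comPzRingType.

(** A complex of free modules of finite rank with chosen bases: fd_coef t i a
    c, for a and c below the ranks, is the entry of the differential out of
    degree i. *)
Record free_data := FreeData { fd_rank : int -> nat; fd_coef : int -> nat -> nat -> R }.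
Implicit Types (t : free_data) (X Y : complex R).

Definition family X := forall i, nat -> X i.

(** The chain maps from the free complex t to X, given by the images x i a of
    its basis vectors. *)
Definition chain_family t X (x : family X) := forall i a, (a < fd_rank t i)%N ->
  cpx_diff X i (i + 1) (x i a) = lcomb (fd_rank t (i + 1)) (fd_coef t i a) (x (i + 1)).

(** The homotopy y i is indexed by the basis vectors of degree i + 1, on which
    it takes values in degree i. *)
Definition null_homotopic t X (x : family X) := exists y : family X,
  forall i a, (a < fd_rank t (i + 1))%N -> x (i + 1) a =
    cpx_diff X i (i + 1) (y i a) +
    lcomb (fd_rank t (i + 1 + 1)) (fd_coef t (i + 1) a) (y (i + 1)).

Definition vanishes t X := forall x : family X, chain_family t x -> null_homotopic t x.

(** The last condition is exactness of the dual of t in degrees close to 0; it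
    makes the maps from t to shifts of R by less than about n null-homotopic.
    Boundedness makes maps from t insensitive to quasi-isomorphisms. *)
Definition test_data n t :=
  [/\ forall i a e, (a < fd_rank t i)%N -> (e < fd_rank t (i + 1 + 1))%N ->
        \sum_(c < fd_rank t (i + 1)) fd_coef t i a c * fd_coef t (i + 1) c e = 0,
      exists N : nat, forall i, (N < `|i|)%N -> fd_rank t i = 0%N &
      forall j : int, (`|j| < n)%N -> forall w : nat -> R,
        (forall a, (a < fd_rank t j)%N -> \sum_(c < fd_rank t (j + 1)) fd_coef t j a c * w c = 0) ->
        exists w' : nat -> R, forall c, (c < fd_rank t (j + 1))%N ->
          w c = \sum_(e < fd_rank t (j + 1 + 1)) fd_coef t (j + 1) c e * w' e].

(** The sign s absorbs those in the differentials of shifts and cones. *)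
Definition fd_shift k (s : R) t :=
  FreeData (fun i => fd_rank t (i + k)) (fun i a c => s * fd_coef t (i + k) a c).

Lemma test_data_shift n t k s : s * s = 1 -> test_data n t -> test_data (n - `|k|) (fd_shift k s t).
Proof.
move=> ss [tt [N tN] ex]; have ik i : i + 1 + k = i + k + 1 by rewrite addrAC.
split=> /=.
- move=> i a e; rewrite !ik => ai ei.
  rewrite (eq_bigr (fun c : 'I__ => fd_coef t (i + k) a c * fd_coef t (i + k + 1) c e)) => [|c _].
    exact: tt.
  by rewrite mulrACA ss mul1r.
- by exists (N + `|k|)%N => i iN; apply: tN; lia.
- move=> j jn w; rewrite !ik => w0.
  have [||w' w'E] := ex (j + k) _ w; first by lia.
    move=> a aj; have := congr1 ( *%R s) (w0 a aj); rewrite mulr0 mulr_sumr.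
    by under eq_bigr do rewrite !mulrA ss mul1r.
  exists (fun e => s * w' e) => c cj; rewrite w'E //; apply: eq_bigr => e _.
  by rewrite mulrACA ss mul1r.
Qed.

Lemma null_homotopic0 t X : null_homotopic t (fun i a => 0 : X i).
Proof. by exists (fun i a => 0) => i a _; rewrite linear0 lcomb0 addr0. Qed.

Lemma null_homotopicD t X (x y : family X) : null_homotopic t x -> null_homotopic t y -> null_homotopic t (fun i a => x i a + y i a).
Proof.
move=> [v vE] [w wE]; exists (fun i a => v i a + w i a) => i a ai.
by rewrite vE // wE // linearD lcombD addrACA.
Qed.

Lemma null_homotopicN t X (x : family X) : null_homotopic t x -> null_homotopic t (fun i a => - x i a).
Proof.
move=> [v vE]; exists (fun i a => - v i a) => i a ai.
by rewrite vE // linearN lcombN opprD.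
Qed.

Lemma null_homotopic_ext t X (x y : family X) :
  (forall i a, (a < fd_rank t i)%N -> x i a = y i a) -> null_homotopic t x -> null_homotopic t y.
Proof. by move=> xy [v vE]; exists v => i a ai; rewrite -xy // vE. Qed.

Lemma chain_family0 t X : chain_family t (fun i a => 0 : X i).
Proof. by move=> i a _; rewrite linear0 lcomb0. Qed.

Lemma chain_familyB t X (x y : family X) : chain_family t x -> chain_family t y -> chain_family t (fun i a => x i a - y i a).
Proof. by move=> xc yc i a ai; rewrite linearB xc // yc // lcombB. Qed.

Lemma chain_family_map t X Y (f : chain_map X Y) (x : family X) :
  chain_family t x -> chain_family t (fun i a => f i (x i a)).
Proof. by move=> xc i a ai; rewrite -cm_comm xc // linear_lcomb. Qed.

Lemma null_homotopic_map t X Y (f : chain_map X Y) (x : family X) :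
  null_homotopic t x -> null_homotopic t (fun i a => f i (x i a)).
Proof.
move=> [y yE]; exists (fun i a => f i (y i a)) => i a ai.
by rewrite yE // linearD cm_comm linear_lcomb.
Qed.

(** A bounded complex of free modules has only null-homotopic maps to an
    acyclic complex. The homotopy is built downwards from the top degree: what
    is left of x in degree i + 1 is a cocycle, and any of its primitives
    serves as the next value. *)
Lemma acyclic_vanishes n t X : test_data n t -> (forall i, acyclic_at X i) -> vanishes t X.
Proof.
move=> [tt [N tN] _] Xa x xc.
have [y yE] : exists y : family X, forall i, N%:Z - N.*2.+2%:Z <= i ->
    forall a, (a < fd_rank t (i + 1))%N -> x (i + 1) a =
    cpx_diff X i (i + 1) (y i a) +
    lcomb (fd_rank t (i + 1 + 1)) (fd_coef t (i + 1) a) (y (i + 1)).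
  elim: N.*2.+2 => [|s [y yE]].
    by exists (fun i a => 0) => i iN a; rewrite tN //; lia.
  (* The homotopy is known above i0 and is now defined in degree i0. *)
  pose i0 := N%:Z - s.+1%:Z.
  pose w a := x (i0 + 1) a - lcomb (fd_rank t (i0 + 1 + 1)) (fd_coef t (i0 + 1) a) (y (i0 + 1)).
  have wb a : exists v : X i0, (a < fd_rank t (i0 + 1))%N -> cpx_diff X i0 (i0 + 1) v = w a.
    have [ai|//] := ltnP a (fd_rank t (i0 + 1)); last by exists 0.
    have [v vE] : exists v, cpx_diff X i0 (i0 + 1) v = w a; last by exists v.
    apply: coboundary_pred => //; apply: Xa; rewrite /cocycle linearB xc // linear_lcomb -lcombB.
    rewrite (@eq_lcomb _ _ _ _ _ (fun c => lcomb (fd_rank t (i0 + 1 + 1 + 1)) (fd_coef t (i0 + 1 + 1) c) (y (i0 + 1 + 1)))).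
      by rewrite lcomb_lcomb; apply: lcomb_eq0 => e ei; exact: tt.
    move=> c ci; rewrite yE //; last by rewrite /i0; lia.
    by rewrite [LHS]addrC addKr.
  have [v vE] := choice wb.
  exists (dfwith y v) => i iN a ai.
  have [e|ne] := eqVneq i0 i.
    case: _ / e iN ai => iN ai; rewrite dfwith_in dfwith_out; last by apply/eqP; lia.
    by rewrite vE // subrK.
  rewrite !dfwith_out //; last by rewrite /i0 in ne *; apply/eqP => E; lia.
  by apply: yE => //; rewrite /i0 in ne; move/eqP: ne; lia.
exists y => i a ai; apply: yE => //.
by rewrite leNgt; apply/negP => iN; rewrite tN in ai => //; lia.
Qed.

End Families.

(** * Exactness along mapping cones *)

Section ConeFamilies.
Variables (R : comPzRingType) (X Y : complex R) (u : chain_map X Y) (t : free_data R).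

Lemma lcomb_pair (U V : lmodType R) n A (z : nat -> (U * V)%type) :
  lcomb n A z = (lcomb n A (fun c => (z c).1), lcomb n A (fun c => (z c).2)).
Proof. by rewrite [LHS]surjective_pairing /lcomb !raddf_sum. Qed.

(** This and the next two lemmas are the parts that are needed of the long
    exact sequence of homotopy classes of maps from t along X -> Y -> cone u
    -> X[1]. *)
Lemma cone_vanishes_onto (y : family Y) : vanishes t (cone u) -> chain_family t y ->
  exists2 x : family X, chain_family t x & null_homotopic t (fun i a => y i a - u i (x i a)).
Proof.
move=> van yc.
have [|z zE] := van (fun i a => (y i a, 0) : cone u i).
  move=> i a ai; rewrite cone_diffE /= !linear0 addr0 yc //.
  by rewrite lcomb_pair /= lcomb0.
have [x xE] := reindex_fam (fun i a => (z i a).2).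
exists x.
  apply: int_succ => i a ai; rewrite !xE.
  have := congr1 snd (zE i a ai); rewrite cone_diffE lcomb_pair /=.
  by move=> /esym/eqP; rewrite addr_eq0 eqr_opp => /eqP ->.
exists (fun i a => (z i a).1) => i a ai; rewrite xE.
have := congr1 fst (zE i a ai); rewrite cone_diffE lcomb_pair /= => ->.
by rewrite addrAC addrK.
Qed.

Lemma cone_vanishes_inj (x : family X) : vanishes (fd_shift 1 (-1) t) (cone u) ->
  chain_family t x -> null_homotopic t (fun i a => u i (x i a)) -> null_homotopic t x.
Proof.
move=> van xc [y yE].
have [|z zE] := van (fun i a => (- y i a, x (i + 1) a) : cone u i).
  move=> i a /= ai; rewrite cone_diffE /= yE // xc //.
  rewrite lcomb_pair /=; congr (_, _).
    by rewrite linearN addKr lcombN (lcombZl _ _ _ (-1)) scaleN1r opprK.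
  by rewrite (lcombZl _ _ _ (-1)) scaleN1r.
have [w wE] := reindex_fam (fun i a => - (z i a).2).
exists w; apply: int_succ => i a ai; rewrite !wE.
have := congr1 snd (zE i a ai); rewrite cone_diffE lcomb_pair /= => ->.
rewrite linearN; congr (_ + _).
by rewrite (lcombZl _ _ _ (-1)) scaleN1r -lcombN.
Qed.

Lemma cone_vanishes : vanishes t Y -> vanishes (fd_shift (-1) (-1) t) X ->
  vanishes t (cone u).
Proof.
move=> vY vX z zc.
have zc1 i a : (a < fd_rank t i)%N -> cpx_diff Y i (i + 1) (z i a).1 + u (i + 1) (z i a).2 =
    lcomb (fd_rank t (i + 1)) (fd_coef t i a) (fun c => (z (i + 1) c).1).
  by move=> ai; have := congr1 fst (zc i a ai); rewrite cone_diffE lcomb_pair.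
have zc2 i a : (a < fd_rank t i)%N -> - cpx_diff X (i + 1) (i + 1 + 1) (z i a).2 =
    lcomb (fd_rank t (i + 1)) (fd_coef t i a) (fun c => (z (i + 1) c).2).
  by move=> ai; have := congr1 snd (zc i a ai); rewrite cone_diffE lcomb_pair.
have [x xE] := reindex_fam (fun i a => (z i a).2).
have [|w wE] := vX x.
  apply: int_succ => i a /=; rewrite !addrK => ai.
  by rewrite !xE -[LHS]opprK zc2 // (lcombZl _ _ _ (-1)) scaleN1r.
have {}wE i a : (a < fd_rank t i)%N -> (z i a).2 = cpx_diff X i (i + 1) (w i a) -
    lcomb (fd_rank t (i + 1)) (fd_coef t i a) (w (i + 1)).
  move=> ai; rewrite -[LHS]/((fun a => (z i a).2) a) -xE wE /= !addrK //.
  by rewrite (lcombZl _ _ _ (-1)) scaleN1r.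
have [|y yE] := vY (fun i a => (z i a).1 + u i (w i a)).
  move=> i a ai; rewrite linearD lcombD -zc1 // -addrA; congr (_ + _).
  by rewrite wE // linearB cm_comm linear_lcomb subrK.
exists (fun i a => (y i a, - w (i + 1) a)) => i a ai.
rewrite cone_diffE lcomb_pair [LHS]surjective_pairing /= pair_add; congr (_, _).
  by rewrite linearN [RHS]addrAC; exact: canRL (addrK _) (yE i a ai).
by rewrite wE // linearN opprK lcombN.
Qed.

End ConeFamilies.

(** * Functors defined for almost all test data *)

Section Eventually.
Variable R : comPzRingType.
Implicit Types (P Q : free_data R -> Prop) (t : free_data R).

(** A morphism or an object of the singularity category determines a bound,
    beyond which the test data behave well for it. The bound must not depend
    on the test datum, nor on the chain maps out of it. *)
Definition eventually P := exists n0, forall n t, (n0 <= n)%N -> test_data n t -> P t.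

Lemma eventually_mono P Q : eventually P -> (forall t, P t -> Q t) -> eventually Q.
Proof. by move=> [n0 H] PQ; exists n0 => n t n0n tn; apply/PQ/(H n). Qed.

Lemma eventually_and P Q : eventually P -> eventually Q -> eventually (fun t => P t /\ Q t).
Proof.
move=> [m H] [n K]; exists (maxn m n) => p t; rewrite geq_max => /andP[mp np] tp.
by split; [exact: H tp|exact: K tp].
Qed.

Lemma eventually_all P : (forall t, P t) -> eventually P.
Proof. by move=> H; exists 0%N. Qed.

Lemma eventually_test_data P : (forall n t, test_data n t -> P t) -> eventually P.
Proof. by move=> H; exists 0%N => n t _; exact: H. Qed.

Lemma eventually_shift P k s : s * s = 1 -> eventually P -> eventually (fun t => P (fd_shift k s t)).
Proof.
move=> ss [n0 H]; exists (n0 + `|k|)%N => n t nn tn.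
by apply: (H (n - `|k|)%N); [lia|exact: test_data_shift].
Qed.

(** A functor to sets with an equivalence relation, one for each test datum,
    for which every instance of functoriality is only required eventually. *)
Record efunctor (C : category) := EFunctor {
  obj : free_data R -> C -> Type;
  sim : forall t X, obj t X -> obj t X -> Prop;
  pt : forall t X, obj t X;
  act : forall t X Y, hom X Y -> obj t X -> obj t Y;
  sim_refl : forall t X (x : obj t X), sim x x;
  sim_sym : forall t X (x y : obj t X), sim x y -> sim y x;
  sim_trans : forall t X (x y z : obj t X), sim x y -> sim y z -> sim x z;
  act_sim : forall X Y (f : hom X Y),
    eventually (fun t => forall x y : obj t X, sim x y -> sim (act f x) (act f y));
  act_eqm : forall X Y (f g : hom X Y), eqm f g ->
    eventually (fun t => forall x : obj t X, sim (act f x) (act g x));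
  act_id : forall X, eventually (fun t => forall x : obj t X, sim (act (idm X) x) x);
  act_comp : forall X Y Z (g : hom Y Z) (f : hom X Y),
    eventually (fun t => forall x : obj t X, sim (act (comp g f) x) (act g (act f x))) }.

Definition inverted (C : category) (F : efunctor C) (X Y : C) (s : hom X Y) :=
  eventually (fun t => (forall x y : obj F t X, sim (act s x) (act s y) -> sim x y) /\
    forall y : obj F t Y, exists x : obj F t X, sim (act s x) y).

Section FunctorFacts.
Variables (C : category) (F : efunctor C).
Implicit Types X Y Z : C.

Lemma act_inverse X Y (f : hom X Y) (g : hom Y X) : inverse f g ->
  eventually (fun t => forall x : obj F t X, sim (act g (act f x)) x).
Proof.
move=> [gf _]; apply: eventually_mono (eventually_and (act_comp F g f) (eventually_and (act_eqm F gf) (act_id F X))) _.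
move=> t [H1 [H2 H3]] x; apply: sim_trans (sim_sym (H1 x)) _.
exact: sim_trans (H2 x) (H3 x).
Qed.

Lemma act_square X Y X' Y' (s : hom X Y) (a : hom X' X) (b : hom Y' Y) (u : hom X' Y') :
  eqm (comp s a) (comp b u) ->
  eventually (fun t => forall x : obj F t X', sim (act s (act a x)) (act b (act u x))).
Proof.
move=> E; apply: eventually_mono (eventually_and (act_comp F s a) (eventually_and (act_eqm F E) (act_comp F b u))) _.
move=> t [H1 [H2 H3]] x; apply: sim_trans (sim_sym (H1 x)) _.
exact: sim_trans (H2 x) (H3 x).
Qed.

Lemma inverted_square X Y X' Y' (s : hom X Y) (a : hom X' X) (b : hom Y' Y) (u : hom X' Y') :
  eqm (comp s a) (comp b u) -> is_iso a -> is_iso b -> inverted F u -> inverted F s.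
Proof.
move=> E [a' [aa' a'a]] [b' [bb' b'b]] ui.
apply: eventually_mono (eventually_and (eventually_and (act_square E) (eventually_and (act_inverse (conj a'a aa'))
  (eventually_and (act_inverse (conj bb' b'b)) (act_inverse (conj b'b bb')))))
  (eventually_and ui (eventually_and (act_sim F s) (eventually_and (act_sim F a) (eventually_and (act_sim F b) (act_sim F b')))))) _.
move=> t [[sq [aK [bK b'K]]] [[uI uS] [sS [aS [bS b'S]]]]]; split=> [x y xy|y].
  have H (z : obj F t X) : sim (act b (act u (act a' z))) (act s z).
    exact: sim_trans (sim_sym (sq _)) (sS _ _ (aK z)).
  have /uI/aS : sim (act u (act a' x)) (act u (act a' y)).
    apply: sim_trans (sim_sym (bK _)) (sim_trans _ (bK _)); apply: b'S.
    exact: sim_trans (H x) (sim_trans xy (sim_sym (H y))).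
  move=> xy'; exact: sim_trans (sim_sym (aK x)) (sim_trans xy' (aK y)).
have [x xE] := uS (act b' y); exists (act a x).
apply: sim_trans (sq _) _; exact: sim_trans (bS _ _ xE) (b'K y).
Qed.

Lemma act_trivial X Y (f : hom X Y) : is_iso f ->
  eventually (fun t => forall x y : obj F t X, sim x y) ->
  eventually (fun t => forall x y : obj F t Y, sim x y).
Proof.
move=> [g [gf fg]] H.
apply: eventually_mono (eventually_and H (eventually_and (act_sim F f) (act_inverse (conj fg gf)))) _.
move=> t [XX [fS fK]] x y; apply: sim_trans (sim_sym (fK x)) (sim_trans _ (fK y)).
exact/fS/XX.
Qed.

End FunctorFacts.

Section LocalizedFunctor.
Variables (C : category) (W : forall X Y : C, hom X Y -> Prop) (F : efunctor C).
Hypothesis W_inverted : forall X Y (s : hom X Y), W s -> inverted F s.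

(** A chosen preimage of y. The default value is used only for the test data
    for which s does not yet act surjectively. *)
Definition unact t X Y (s : hom X Y) (y : obj F t Y) : obj F t X :=
  if pselect (exists x, sim (act s x) y) is left ex then sval (cid ex) else pt F t X.

Fixpoint loc_act t (X Y : C) (f : loc_hom W X Y) : obj F t X -> obj F t Y :=
  match f in loc_hom _ X Y return obj F t X -> obj F t Y with
  | loc_of _ _ f => fun x => act f x
  | loc_inv _ _ s _ => fun y => unact s y
  | loc_comp _ _ _ g f => fun x => loc_act g (loc_act f x)
  end.

Lemma unactK X Y (s : hom X Y) : W s -> eventually (fun t =>
  (forall x : obj F t X, sim (unact s (act s x)) x) /\
  (forall y : obj F t Y, sim (act s (unact s y)) y)).
Proof.
move=> /W_inverted; move/eventually_mono; apply => t [sI sS].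
have H (y : obj F t Y) : sim (act s (unact s y)) y.
  rewrite /unact; case: pselect => [ex|/(_ (sS y))//].
  by case: cid.
by split=> // x; apply: sI.
Qed.

Lemma loc_act_sim X Y (f : loc_hom W X Y) :
  eventually (fun t => forall x y : obj F t X, sim x y -> sim (loc_act f x) (loc_act f y)).
Proof.
elim: f => {X Y} [X Y f|X Y s Ws|X Y Z g IHg f IHf] /=.
- exact: act_sim.
- apply: eventually_mono (eventually_and (unactK Ws) (W_inverted Ws)) _ => t [[_ sK] [sI _]] x y xy.
  apply: sI; apply: sim_trans (sK x) (sim_trans xy (sim_sym (sK y))).
- by apply: eventually_mono (eventually_and IHg IHf) _ => t [gS fS] x y xy; apply/gS/fS.
Qed.

(** A derivation of an equality in the localization uses finitely many
    relations, each valid eventually. *)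
Lemma loc_act_eqm X Y (f g : loc_hom W X Y) : loc_eqm f g ->
  eventually (fun t => forall x : obj F t X, sim (loc_act f x) (loc_act g x)).
Proof.
elim=> {X Y f g} /=.
- by move=> X Y f; apply: eventually_all => t x; exact: sim_refl.
- by move=> X Y f g _ /eventually_mono; apply => t H x; exact/sim_sym/H.
- move=> X Y f g h _ H _ K; apply: eventually_mono (eventually_and H K) _ => t [{}H {}K] x.
  exact: sim_trans (H x) (K x).
- move=> X Y Z g g' f f' _ H _ K.
  apply: eventually_mono (eventually_and (eventually_and H K) (loc_act_sim g)) _ => t [[{}H {}K] gS] x.
  exact: sim_trans (gS _ _ (K x)) (H _).
- by move=> *; apply: eventually_all => t x; exact: sim_refl.
- by move=> X Y f; apply: eventually_mono (act_id F Y) _ => t H x; exact: H.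
- move=> X Y f; apply: eventually_mono (eventually_and (act_id F X) (loc_act_sim f)) _ => t [H K] x.
  exact/K/H.
- by move=> X Y f g fg; exact: act_eqm.
- by move=> X Y Z g f; exact: act_comp.
- move=> X Y s Ws; apply: eventually_mono (eventually_and (unactK Ws) (act_id F X)) _ => t [[H _] K] x.
  exact: sim_trans (H x) (sim_sym (K x)).
- move=> X Y s Ws; apply: eventually_mono (eventually_and (unactK Ws) (act_id F Y)) _ => t [[_ H] K] x.
  exact: sim_trans (H x) (sim_sym (K x)).
Qed.

Definition localized : efunctor (localization W).
Proof.
refine (@EFunctor (localization W) (obj F) (sim (e := F)) (pt F)
  loc_act (sim_refl (e := F)) (sim_sym (e := F)) (sim_trans (e := F)) loc_act_sim loc_act_eqm _ _).
- by move=> X; exact: (act_id F X).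
- by move=> X Y Z g f; apply: eventually_all => t x; exact: sim_refl.
Defined.

End LocalizedFunctor.

Section RestrictedFunctor.
Variables (C : category) (P : C -> Prop) (F : efunctor C).

Definition restricted : efunctor (full_subcategory P).
Proof.
refine (@EFunctor (full_subcategory P) (fun t X => obj F t (sval X))
  (fun t X => sim (t := t) (X := sval X)) (fun t X => pt F t (sval X))
  (fun t X Y f => act (e := F) (t := t) f) _ _ _ _ _ _ _).
- by move=> t X; exact: sim_refl.
- by move=> t X; exact: sim_sym.
- by move=> t X; exact: sim_trans.
- by move=> X Y f; exact: (act_sim F f).
- by move=> X Y f g; exact: (@act_eqm _ F _ _ f g).
- by move=> X; exact: (act_id F (sval X)).
- by move=> X Y Z g f; exact: (act_comp F g f).
Defined.

End RestrictedFunctor.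
End Eventually.

(** * The test functor on the singularity category *)

Section FamilyFunctor.
Variable R : comPzRingType.
Implicit Types (X Y Z : complex R) (t : free_data R).

Definition chain_families t X := {x : family X | chain_family t x}.

Definition homotopic t X (x y : chain_families t X) := null_homotopic t (fun i a => sval x i a - sval y i a).

Definition zero_family t X : chain_families t X := exist _ _ (@chain_family0 R t X).

Definition chain_families_map t X Y (f : chain_map X Y) (x : chain_families t X) : chain_families t Y :=
  exist _ _ (chain_family_map f (svalP x)).

Definition family_functor : efunctor R (complexes R).
Proof.
refine (@EFunctor R (complexes R) chain_families homotopic zero_family chain_families_map _ _ _ _ _ _ _).
- move=> t X x; apply: null_homotopic_ext (null_homotopic0 t X) => i a _; exact/esym/subrr.
- move=> t X x y /null_homotopicN; apply: null_homotopic_ext => i a _; exact: opprB.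
- move=> t X x y z /null_homotopicD H /H; apply: null_homotopic_ext => i a _.
  by rewrite addrA subrK.
- move=> X Y f; apply: eventually_all => t x y /(null_homotopic_map f); apply: null_homotopic_ext => i a _.
  exact: linearB.
- move=> X Y f g fg; apply: eventually_all => t x; apply: null_homotopic_ext (null_homotopic0 t Y) => i a _ /=.
  by rewrite fg subrr.
- move=> X; apply: eventually_all => t x; apply: null_homotopic_ext (null_homotopic0 t X) => i a _ /=.
  by rewrite subrr.
- move=> X Y Z g f; apply: eventually_all => t x; apply: null_homotopic_ext (null_homotopic0 t Z) => i a _ /=.
  by rewrite subrr.
Defined.

Lemma vanishes_homotopic t X : vanishes t X <-> forall x y : chain_families t X, homotopic x y.
Proof.
split=> [H x y|H x x0]; first exact: H _ (chain_familyB (svalP x) (svalP y)).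
apply: null_homotopic_ext (H (exist _ x x0) (zero_family t X)) => i a _; exact: subr0.
Qed.

Lemma sqrrN1 : -1 * -1 = 1 :> R. Proof. by rewrite mulrNN mulr1. Qed.

(** By the long exact sequence it suffices that the maps to the cone and to
    its shift are null-homotopic. *)
Lemma inverted_cone X Y (u : chain_map X Y) :
  eventually (fun t => vanishes t (cone u)) -> inverted (X := X) (Y := Y) family_functor u.
Proof.
move=> H; apply: eventually_mono (eventually_and H (eventually_shift 1 sqrrN1 H)) _.
move=> t [{}H H']; split=> [x y xy|y].
  apply: cone_vanishes_inj H' (chain_familyB (svalP x) (svalP y)) _.
  by apply: null_homotopic_ext xy => i a _; rewrite linearB.
have [x xc yx] := cone_vanishes_onto H (svalP y); exists (exist _ x xc).
by apply: null_homotopic_ext (null_homotopicN yx) => i a _; exact: opprB.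
Qed.

Lemma quasi_iso_cone X Y (s : chain_map X Y) :
  quasi_iso s -> forall i, acyclic_at (cone s) i.
Proof.
move=> sq; apply: int_succ => i [y x] /cone_cocycleP[yx xc].
have [inj _] := (quasi_isoP s).1 sq (i + 1 + 1).
have [_ surj] := (quasi_isoP s).1 sq (i + 1).
have /(coboundary_pred erefl)[x0 x0E] : coboundary x.
  apply: inj => //; exists (i + 1), (- y); rewrite linearN.
  by apply/eqP; rewrite eqr_oppLR -addr_eq0 yx.
have [|x1 x1c /(coboundary_pred erefl)[w wE]] := surj (y + s (i + 1) x0).
  by rewrite /cocycle linearD -cm_comm x0E.
apply/cone_coboundary; exists w, (x1 - x0); split.
  by rewrite wE linearB addrA subrK addrK.
by rewrite linearB x1c x0E sub0r opprK.
Qed.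

Lemma inverted_quasi_iso X Y (s : chain_map X Y) :
  quasi_iso s -> inverted (X := X) (Y := Y) family_functor s.
Proof.
move=> sq; apply: inverted_cone; apply: eventually_test_data => n t tn.
exact: acyclic_vanishes tn (quasi_iso_cone sq).
Qed.

Definition D_functor : efunctor R (D R) :=
  @localized R (complexes R) (@quasi_iso R) family_functor inverted_quasi_iso.

Definition eventually_vanishes (X : D R) := eventually (fun t => vanishes t X).

Lemma eventually_vanishes_iso (X Y : D R) : isomorphic X Y -> eventually_vanishes X -> eventually_vanishes Y.
Proof.
move=> [f fi] H; apply: eventually_mono (@act_trivial R (D R) D_functor X Y f fi _) _.
  by apply: eventually_mono H _ => t /vanishes_homotopic.
by move=> t /vanishes_homotopic.
Qed.

Lemma vanishes_shift n t X :
  vanishes (fd_shift (- n) ((-1) ^+ `|n|%N) t) X -> vanishes t (shift n X).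
Proof.
set s := (-1) ^+ _ => van x xc.
have ss : s * s = 1 by rewrite -expr2 sqrr_sign.
have [x' x'E] := reindex_fam (X := X) (fun i => (x i : nat -> X (i + n))).
have [|y yE] := van x'.
  move=> j; rewrite -[j](subrK n); move: (j - n) => i a /=.
  rewrite (addrAC i n 1) !addrK => ai; rewrite !x'E lcombZl -xc //=.
  by rewrite scalerA ss scale1r.
exists (fun i a => s *: y (i + n) a) => i a ai.
have := yE (i + n) a; rewrite /= (addrAC i n 1) addrK => /(_ ai).
rewrite x'E => ->; rewrite linearZ /= !scalerA ss scale1r; congr (_ + _).
by rewrite (addrAC (i + 1) n 1) addrK lcombZl lcombZ.
Qed.

Lemma eventually_vanishes_cone X Y (u : chain_map X Y) :
  eventually_vanishes X -> eventually_vanishes Y -> eventually_vanishes (cone u).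
Proof.
move=> HX HY; apply: eventually_mono (eventually_and HY (eventually_shift (-1) sqrrN1 HX)) _ => t [].
exact: cone_vanishes.
Qed.

(** The bound n0 of the definition grows by the length of a shift and by at
    most one for a cone, hence stays finite. *)
Lemma eventually_vanishes_thick : is_thick eventually_vanishes.
Proof.
split.
- exact: eventually_vanishes_iso.
- apply: eventually_all => t x _; apply: null_homotopic_ext (null_homotopic0 t _) => i a _.
  by rewrite [x i a]rV0_eq0.
- move=> n X H; have ss : (-1) ^+ `|n|%N * (-1) ^+ `|n|%N = 1 :> R.
    by rewrite -expr2 sqrr_sign.
  by apply: eventually_mono (eventually_shift (- n) ss H) _ => t; exact: vanishes_shift.
- move=> X Y s Z [A [B [u [a [b [ai bi _ cZ]]]]]] HX HY.
  apply: eventually_vanishes_iso cZ _; apply: eventually_vanishes_cone.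
    by apply: eventually_vanishes_iso HX; apply: isomorphic_sym; exists a.
  by apply: eventually_vanishes_iso HY; apply: isomorphic_sym; exists b.
- move=> X Y H; apply: eventually_mono H _ => t H x xc.
  have [|y yE] := H (fun i a => (x i a, 0)).
    by move=> i a ai; rewrite /= /sum_diff /= linear0 xc // lcomb_pair lcomb0.
  exists (fun i a => (y i a).1) => i a ai.
  by have := congr1 fst (yE i a ai); rewrite lcomb_pair.
Qed.

(** A chain map from t to R is a functional on the module of t in degree 0
    that vanishes on boundaries. Exactness of the dual of t makes it extend
    along the differential out of degree 0, which is a null-homotopy. *)
Lemma eventually_vanishes_R : eventually_vanishes (stalk (R^o : lmodType R)).
Proof.
exists 2%N => n t n2 [_ _ ex] x xc.
(* The exactness condition indexed by j concerns degree j + 1; for degree 0 it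
   asks that n exceeds 1. *)
have [|a ai|w wE] := ex (-1) _ (x 0); first by lia.
  exact: esym (xc (-1) a ai).
exists (fun i a => @degree_cast _ (stalk (R^o : lmodType R)) 0 i (w a)) => i a ai.
rewrite [cpx_diff _ _ _ _]/(0) add0r.
have [e|e] := eqVneq i (-1).
  subst i; rewrite (wE a ai); apply: eq_bigr => c _.
  by rewrite (degree_castK (X := stalk (R^o : lmodType R))).
rewrite [LHS]stalk_mod_eq0; last by apply/eqP; move/eqP: e; lia.
by apply/esym/big1 => c _; rewrite [_ *: _]stalk_mod_eq0 //; apply/eqP; move/eqP: e; lia.
Qed.

Lemma perfect_eventually_vanishes X : perfect X -> eventually_vanishes X.
Proof. by move=> PX; apply: PX; [exact: eventually_vanishes_thick|exact: eventually_vanishes_R]. Qed.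

Definition Df_functor : efunctor R (Df R) :=
  @restricted R (D R) (@total_cohomology_fin_gen R) D_functor.

Lemma inverted_perfect_cone (X Y : Df R) (s : hom X Y) :
  perfect_cone s -> inverted Df_functor s.
Proof.
move=> [Z [A [B [u [a [b [ai bi sq cZ]]]]]] /perfect_eventually_vanishes HZ].
apply: (@inverted_square R (D R) D_functor _ _ A B s a b (in_D u) sq ai bi).
by apply: inverted_cone; apply: eventually_vanishes_iso HZ; exact: isomorphic_sym.
Qed.

Definition Dsg_functor : efunctor R (Dsg R) :=
  @localized R (Df R) (@perfect_cone R) Df_functor inverted_perfect_cone.

(** What the equality r id_X = 0 says after the test functors have been
    applied to it. *)
Lemma acts_as_zero_null_homotopic r (X : Dsg R) : acts_as_zero r X ->
  eventually (fun t => forall x : family (sval X), chain_family t x -> null_homotopic t (fun i a => r *: x i a)).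
Proof.
move=> /(@act_eqm R (Dsg R) Dsg_functor) H; apply: eventually_mono H _ => t H x xc.
by apply: null_homotopic_ext (H (exist _ x xc)) => i a _; rewrite /= subr0.
Qed.

End FamilyFunctor.

(** * Free resolutions and dualized resolutions as complexes *)

Section FreeComplex.
Variables (R : comPzRingType) (noeth : noetherian R).
Variables (p : nat -> nat) (d : nat -> nat -> nat -> R).
Notation dm k := (mx (p k.+1) (p k) (d k)).
Hypothesis ex : forall k (v : 'rV_(p k.+1)),
  v *m dm k = 0 <-> exists w : 'rV_(p k.+2), w *m dm k.+1 = v.

Lemma diff_diff k (v : 'rV_(p k.+2)) : v *m dm k.+1 *m dm k = 0.
Proof. by apply/ex; exists v. Qed.

(** A resolution P is a complex in non-positive degrees, with P_n in degree -
    n. *)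
Definition rk (i : int) := if i <= 0 then p `|i| else 0%N.

Lemma rkN n : rk (- n%:Z) = p n.
Proof. by rewrite /rk ifT; [congr p; lia|lia]. Qed.

Lemma rk_gt0 i (v : 'rV[R]_(rk i)) : 0 < i -> v = 0.
Proof.
by move=> i0; move: v; rewrite /rk leNgt i0 /= => v; exact: rV0_eq0.
Qed.

Definition free_diff i j : {linear 'rV[R]_(rk i) -> 'rV[R]_(rk j)} :=
  mulmxr (if i + 1 == j then mx (rk i) (rk j) (d `|j|%N) else 0).

Lemma free_diffE i (v : 'rV_(rk i)) :
  free_diff i (i + 1)%R v = v *m mx (rk i) (rk (i + 1)%R) (d `|(i + 1)%R|%N).
Proof. by rewrite /= eqxx. Qed.

Lemma neg_or_pos (i : int) : 0 < i \/ exists n : nat, i = - n%:Z.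
Proof. by case: (ltP 0 i) => i0; [left|right; exists `|i|%N; lia]. Qed.

Lemma free_diff_sq i j k v : free_diff j k (free_diff i j v) = 0.
Proof.
have [ij|ij] := eqVneq (i + 1) j; last by rewrite /= (negPf ij) mulmx0 mul0mx.
have [jk|jk] := eqVneq (j + 1) k; last by rewrite /= (negPf jk) mulmx0.
subst j k; case: (neg_or_pos (i + 1 + 1)) => [?|[n e]]; first exact: rk_gt0.
rewrite !free_diffE; move: v.
have -> : rk i = p n.+2 by rewrite (_ : i = - n.+2%:Z) ?rkN //; lia.
have -> : rk (i + 1) = p n.+1 by rewrite (_ : i + 1 = - n.+1%:Z) ?rkN //; lia.
have -> : rk (i + 1 + 1) = p n by rewrite e rkN.
have -> : `|(i + 1)%R|%N = n.+1 by lia.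
have -> : `|(i + 1 + 1)%R|%N = n by lia.
by move=> v; exact: diff_diff.
Qed.

Definition free_complex : complex R.
Proof.
exists (fun i => 'rV[R]_(rk i)) free_diff.
- by move=> i j v ij; rewrite /= (negPf ij) mulmx0.
- exact: free_diff_sq.
Defined.

Lemma free_complex_acyclic i : i != 0 -> acyclic_at free_complex i.
Proof.
move: i; apply: int_succ => i i0 v; case: (neg_or_pos (i + 1)) => [ipos _|[[|n] e]].
- by rewrite (rk_gt0 v ipos); exact: coboundary0.
- by rewrite e in i0.
rewrite /cocycle [cpx_diff _ _ _ _]free_diffE => v0.
suff H (x : 'rV_(rk (i + 1)%R)) :
    x *m mx (rk (i + 1)%R) (rk (i + 1 + 1)%R) (d `|(i + 1 + 1)%R|%N) = 0 ->
    exists w : 'rV_(rk i), w *m mx (rk i) (rk (i + 1)%R) (d `|(i + 1)%R|%N) = x.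
  by have [w wE] := H v v0; exists i, w; rewrite -wE; exact: free_diffE.
move: x; have -> : rk i = p n.+2 by rewrite (_ : i = - n.+2%:Z) ?rkN //; lia.
have -> : rk (i + 1 + 1) = p n by rewrite (_ : i + 1 + 1 = - n%:Z) ?rkN //; lia.
rewrite (_ : `|(i + 1 + 1)%R|%N = n); last by lia.
rewrite (_ : rk (i + 1) = p n.+1); last by rewrite e rkN.
rewrite (_ : `|(i + 1)%R|%N = n.+1); last by lia.
by move=> x /ex.
Qed.

Lemma free_complex_Df : total_cohomology_fin_gen free_complex.
Proof.
apply/total_cohomology_fin_genP; split.
  by exists 0%N => i i0; apply: free_complex_acyclic; apply/eqP; lia.
move=> i; have [|||n [g [g0 gP]]] := noetherian_rows noeth (S := fun v : 'rV_(rk i) =>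
    @cocycle R free_complex i v).
- exact: cocycle0.
- by move=> v w; exact: cocycleD.
- by move=> r v; exact: cocycleZ.
exists n, g; split=> // x /gP[c cE]; exists c.
by rewrite {1}cE subrr; exact: coboundary0.
Qed.

End FreeComplex.

Section TestData.
Variable R : comPzRingType.

Lemma row_mulmx_lcomb m b b' n (C D E F : nat -> nat -> R) a : (a < m)%N ->
  mx m b C *m mx b n D = mx m b' E *m mx b' n F ->
  (\row_(c < b) C a c) *m mx b n D = lcomb b' (E a) (fun c => \row_(e < n) F c e).
Proof.
move=> am H; apply/rowP => e.
transitivity ((mx m b C *m mx b n D) (Ordinal am) e).
  by rewrite !mxE; apply: eq_bigr => j _; rewrite !mxE.
by rewrite H /lcomb summxE mxE; apply: eq_bigr => j _; rewrite !mxE.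
Qed.

Lemma dual_exact_entries m b b' (A A' : nat -> nat -> R) : dual_exact m b b' A A' ->
  (forall a e, (a < m)%N -> (e < b')%N -> \sum_(c < b) A a c * A' c e = 0) /\
  forall w : nat -> R, (forall a, (a < m)%N -> \sum_(c < b) A a c * w c = 0) ->
    exists w' : nat -> R, forall c, (c < b)%N -> w c = \sum_(e < b') A' c e * w' e.
Proof.
move=> [AA H]; split=> [a e am eb|w w0].
  have := congr1 (fun B : 'M_(m, b') => B (Ordinal am) (Ordinal eb)) AA.
  rewrite !mxE => AAae; rewrite -[RHS]AAae.
  by apply: eq_bigr => c _; rewrite !mxE.
have [|w' w'E] := H (\col_c w c).
  apply/colP => a; rewrite !mxE -[RHS](w0 a (ltn_ord a)).
  by apply: eq_bigr => c _; rewrite !mxE.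
exists (fun e => if insub e is Some l then w' l 0 else 0) => c cb.
have := congr1 (fun B : 'cV_b => B (Ordinal cb) 0) w'E.
by rewrite !mxE /= => ->; apply: eq_bigr => e _; rewrite valK !mxE.
Qed.

Section Shifted.
Variables (B : nat -> nat) (E : nat -> nat -> nat -> R) (n : nat).
Hypothesis BE : forall k, dual_exact (B k) (B k.+1) (B k.+2) (E k) (E k.+1).

(** The sequence B is placed with B 0 in degree - n and cut off above degree n
    + 1. This makes the complex bounded and leaves it intact in the degrees
    where exactness of the dual is required. *)
Definition dual_resolution_rank (i : int) :=
  if 0 <= i + n%:Z <= n.*2.+1%:Z then B `|(i + n%:Z)%R|%N else 0%N.

Definition dual_resolution : free_data R := FreeData dual_resolution_rank (fun i => E `|(i + n%:Z)%R|%N).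

Lemma dual_resolution_rankP i a : (a < dual_resolution_rank i)%N ->
  exists k : nat, [/\ i = - n%:Z + k%:Z, (k <= n.*2.+1)%N & (a < B k)%N].
Proof.
rewrite /dual_resolution_rank; case: ifP => // /andP[i0 i1] ai.
by exists `|(i + n%:Z)%R|%N; split=> //; lia.
Qed.

Lemma dual_resolution_rankE k : (k <= n.*2.+1)%N -> dual_resolution_rank (- n%:Z + k%:Z) = B k.
Proof. by move=> kn; rewrite /dual_resolution_rank ifT; [congr B; lia|lia]. Qed.

Lemma dual_resolution_test_data : test_data n dual_resolution.
Proof.
split.
- move=> i a e /= /dual_resolution_rankP[k [ik kn ak]] /dual_resolution_rankP[l [il ln el]].
  have l2 : l = k.+2 by lia.
  subst l; have i1 : i + 1 = - n%:Z + k.+1%:Z by lia.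
  rewrite i1 dual_resolution_rankE ?ik; last by lia.
  have -> : `|(- n%:Z + k%:Z + n%:Z)%R|%N = k by lia.
  have -> : `|(- n%:Z + k.+1%:Z + n%:Z)%R|%N = k.+1 by lia.
  by apply: (dual_exact_entries (BE k)).1.
- by exists n.*2.+1 => i iN /=; rewrite /dual_resolution_rank ifF //; lia.
- move=> j jn w /=; have [k jk] : exists k : nat, j = - n%:Z + k%:Z.
    by exists `|(j + n)%R|%N; lia.
  subst j; rewrite (_ : _ + 1 = - n%:Z + k.+1%:Z); last by lia.
  rewrite (_ : _ + 1 = - n%:Z + k.+2%:Z); last by lia.
  rewrite !dual_resolution_rankE; [|lia|lia|lia].
  have -> : `|(- n%:Z + k%:Z + n%:Z)%R|%N = k by lia.
  have -> : `|(- n%:Z + k.+1%:Z + n%:Z)%R|%N = k.+1 by lia.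
  exact: (dual_exact_entries (BE k)).2.
Qed.

End Shifted.

Lemma dual_exact_lift m b b' l (A A' : nat -> nat -> R) (X : 'M_(b, l)) :
  dual_exact m b b' A A' -> mx m b A *m X = 0 ->
  exists C, X = mx b b' A' *m mx b' l C.
Proof.
move=> [_ H] AX.
have cH e : exists w : 'cV_b', col e X = mx b b' A' *m w.
  apply: H; rewrite (_ : _ *m _ = col e (mx m b A *m X)).
    by rewrite AX; apply/colP => a; rewrite !mxE.
  by apply/colP => a; rewrite !mxE; apply: eq_bigr => c _; rewrite !mxE.
have [w wE] := choice cH.
have [C CE] := mx_onto (\matrix_(c, e) w e c 0); exists C; rewrite -CE.
apply/matrixP => a e; have := congr1 (fun v : 'cV_b => v a 0) (wE e).
by rewrite !mxE => ->; apply: eq_bigr => c _; rewrite !mxE.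
Qed.

(** The comparison theorem in dual form: as the dual of (B, E) is exact, each
    functional on B (k + 1) that vanishes on the image of B k extends to B (k
    + 2), so a map to free modules given in the first two degrees extends to
    all of them. *)
Lemma chain_map_lift (B q : nat -> nat) (E f : nat -> nat -> nat -> R) n C0 C1 :
  (forall k, dual_exact (B k) (B k.+1) (B k.+2) (E k) (E k.+1)) ->
  (forall k, (k.+1 < n)%N ->
    mx (q k) (q k.+1) (f k) *m mx (q k.+1) (q k.+2) (f k.+1) = 0) ->
  mx (B 0) (q 0) C0 *m mx (q 0) (q 1) (f 0) = mx (B 0) (B 1) (E 0) *m mx (B 1) (q 1) C1 ->
  exists C : nat -> nat -> nat -> R, [/\ C 0%N = C0, C 1%N = C1 &
    forall k, (k < n)%N -> mx (B k) (q k) (C k) *m mx (q k) (q k.+1) (f k) =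
      mx (B k) (B k.+1) (E k) *m mx (B k.+1) (q k.+1) (C k.+1)].
Proof.
move=> BE ff C01.
suff [C [? ? H]] : exists C : nat -> nat -> nat -> R, [/\ C 0%N = C0, C 1%N = C1 &
    forall k, (k < (n.-1).+1)%N -> mx (B k) (q k) (C k) *m mx (q k) (q k.+1) (f k) =
      mx (B k) (B k.+1) (E k) *m mx (B k.+1) (q k.+1) (C k.+1)].
  by exists C; split=> // k kn; apply: H; lia.
elim: n ff => [|[|n] IHn] ff.
- exists (fun k => if k is 0 then C0 else C1); split=> // k; rewrite ltnS leqn0.
  by move=> /eqP ->.
- exists (fun k => if k is 0 then C0 else C1); split=> // k; rewrite ltnS leqn0.
  by move=> /eqP ->.
have [|C [e0 e1 H]] := IHn; first by move=> k kn; apply: ff; lia.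
have [|F FE] := @dual_exact_lift _ _ _ _ _ _
    (mx (B n.+1) (q n.+1) (C n.+1) *m mx (q n.+1) (q n.+2) (f n.+1)) (BE n).
  by rewrite mulmxA -H // -mulmxA ff // mulmx0.
exists (fun k => if k == n.+2 then F else C k); split=> // k kn.
have [->|kn'] := eqVneq k n.+1; first by rewrite eqxx ltn_eqF //.
by rewrite !ltn_eqF ?H //; lia.
Qed.

End TestData.

(** * Multiplication on the syzygies of a free resolution *)

Section SyzygyFactor.
Variables (R : comPzRingType) (noeth : noetherian R).
Variables (p : nat -> nat) (d : nat -> nat -> nat -> R).
Notation dm k := (mx (p k.+1) (p k) (d k)).
Hypothesis ex : forall k (v : 'rV_(p k.+1)),
  v *m dm k = 0 <-> exists w : 'rV_(p k.+2), w *m dm k.+1 = v.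

Definition delta (a c : nat) : R := (a == c)%:R.

Lemma mx_delta n : mx n n delta = 1%:M.
Proof. by apply/matrixP => a c; rewrite !mxE. Qed.

Lemma row_onto n (v : 'rV[R]_n) : exists w : nat -> R, v = \row_c w c.
Proof.
exists (fun c => if insub c is Some l then v 0 l else 0).
by apply/rowP => c; rewrite mxE valK.
Qed.

Lemma diff_diff_mx k : dm k.+1 *m dm k = 0.
Proof.
by apply/row_matrixP => i; rewrite row_mul row0; apply/ex;
  exists (delta_mx 0 i); rewrite -rowE.
Qed.

Lemma row_eq_mx m n b c (r : R) (C Y F G Z : nat -> nat -> R) :
  (forall a, (a < m)%N -> r *: (\row_(e < n) C a e) =
     (\row_(e < b) Y a e) *m mx b n F +
     lcomb c (G a) (fun l => \row_(e < n) Z l e)) ->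
  r *: mx m n C = mx m b Y *m mx b n F + mx m c G *m mx c n Z.
Proof.
move=> H; apply/matrixP => a e.
have := congr1 (fun v : 'rV_n => v 0 e) (H a (ltn_ord a)).
rewrite mxE [in LHS]mxE => E; rewrite mxE [in LHS]mxE E [LHS]mxE [RHS]mxE /lcomb summxE.
by congr (_ + _); rewrite !mxE; apply: eq_bigr => l _; rewrite !mxE.
Qed.

(** The test datum is P_(m+1) -> P_m, continued by the dual of a free
    resolution of the cokernel of the transpose of P_(m+1) -> P_m. The
    identities of P_(m+1) and P_m extend to a chain map from it to P, so r
    times this chain map is null-homotopic when r acts as zero on P. In degree
    - m the homotopy says r = Y d + E Z, where d E = 0; multiplying by d on
    the left leaves r d = d Y d. *)
Lemma syzygy_factor r :
  acts_as_zero r (exist _ _ (free_complex_Df noeth ex) : Dsg R) ->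
  exists n0, forall m, (n0 <= m)%N ->
    exists Y : 'M_(p m, p m.+1), r *: dm m = dm m *m Y *m dm m.
Proof.
move=> /acts_as_zero_null_homotopic[n0 H]; exists n0 => m mn0; pose n := m.+1.
have [B [E [B0 B1 E0 BE]]] := dual_exact_sequence noeth (p m.+1) (p m) (d m).
pose q k := p (n - k); pose f k := d (n - k.+1).
have q0 : q 0%N = p m.+1 by rewrite /q subn0.
have q1 : q 1%N = p m by rewrite /q /n subn1.
have f0 : f 0%N = d m by rewrite /f /n subn1.
have [||C [C0 C1 CE]] := @chain_map_lift R B q E f n delta delta BE.
- move=> k kn; have kl : (n - k = (n - k.+2).+2)%N by lia.
  have kl1 : (n - k.+1 = (n - k.+2).+1)%N by lia.
  by rewrite /q /f kl kl1; exact: diff_diff_mx.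
- by rewrite q0 q1 f0 B0 B1 E0 !mx_delta mul1mx mulmx1.
pose t := dual_resolution B E n.
have tn : test_data n t := dual_resolution_test_data n BE.
pose X := free_complex ex.
pose x : family X := fun i a => \row_(c < rk p i) C `|(i + n%:Z)%R|%N a c.
have xc : chain_family t x.
  move=> i a /dual_resolution_rankP[k [ik kn ak]].
  (* Beyond degree 0 the complex P is zero. *)
  have [nk|nk] := leqP n k.
    have i1 : 0 < i + 1 by lia.
    by rewrite [LHS](rk_gt0 _ i1) [RHS](rk_gt0 _ i1).
  suff E' : (\row_(c < rk p i) C `|(i + n%:Z)%R|%N a c) *m
      mx (rk p i) (rk p (i + 1)%R) (d `|(i + 1)%R|%N) =
      lcomb (dual_resolution_rank B n (i + 1)%R) (E `|(i + n%:Z)%R|%N a)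
        (fun c => \row_(e < rk p (i + 1)%R) C `|(i + 1 + n%:Z)%R|%N c e).
    by rewrite [LHS]free_diffE; exact: E'.
  have -> : rk p i = q k by rewrite (_ : i = - (n - k)%N%:Z) ?rkN //; lia.
  have -> : rk p (i + 1) = q k.+1.
    by rewrite (_ : i + 1 = - (n - k.+1)%N%:Z) ?rkN //; lia.
  have -> : `|(i + 1)%R|%N = (n - k.+1)%N by lia.
  have -> : `|(i + n%:Z)%R|%N = k by lia.
  have -> : `|(i + 1 + n%:Z)%R|%N = k.+1 by lia.
  have -> : dual_resolution_rank B n (i + 1) = B k.+1.
    by rewrite (_ : i + 1 = - n%:Z + k.+1%:Z) ?dual_resolution_rankE //; lia.
  exact: row_mulmx_lcomb ak (CE k nk).
have [y yE] := H n t (leqW mn0) tn x xc.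
have [Y YE] := choice (fun a => row_onto (y (- n%:Z) a)).
have [Z ZE] := choice (fun a => row_onto (y (- n%:Z + 1) a)).
(* The homotopy equation in degree - m = - n + 1, where the chain map is the
   identity. *)
have rows a : (a < p m)%N -> r *: (\row_(e < p m) C 1%N a e) =
    (\row_(e < p m.+1) Y a e) *m dm m +
    lcomb (B 2) (E 1%N a) (fun l => \row_(e < p m) Z l e).
  have : (a < dual_resolution_rank B n (- n%:Z + 1)%R)%N ->
      r *: (\row_(c < rk p (- n%:Z + 1)%R) C `|(- n%:Z + 1 + n%:Z)%R|%N a c) =
      (\row_(c < rk p (- n%:Z)%R) Y a c) *m
        mx (rk p (- n%:Z)%R) (rk p (- n%:Z + 1)%R) (d `|(- n%:Z + 1)%R|%N) +
      lcomb (dual_resolution_rank B n (- n%:Z + 1 + 1)%R) (E `|(- n%:Z + 1 + n%:Z)%R|%N a)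
        (fun l => \row_(e < rk p (- n%:Z + 1)%R) Z l e).
    move=> am; have := yE (- n%:Z) a am.
    rewrite YE (eq_lcomb _ (fun l _ => ZE l)) => yEa.
    by apply: etrans yEa _; congr (_ + _); exact: free_diffE.
  have -> : rk p (- n%:Z + 1) = p m by rewrite (_ : _ + 1 = - m%:Z) ?rkN //; lia.
  have -> : dual_resolution_rank B n (- n%:Z + 1) = p m.
    by rewrite (_ : _ + 1 = - n%:Z + 1%:Z) ?dual_resolution_rankE.
  have -> : dual_resolution_rank B n (- n%:Z + 1 + 1) = B 2%N.
    by rewrite (_ : _ + 1 = - n%:Z + 2%:Z) ?dual_resolution_rankE //; lia.
  have -> : `|(- n%:Z + 1 + n%:Z)%R|%N = 1%N by lia.
  have -> : `|(- n%:Z + 1)%R|%N = m by lia.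
  by rewrite rkN.
have := row_eq_mx rows; rewrite C1 mx_delta => E1.
exists (mx (p m) (p m.+1) Y).
have EE : dm m *m mx (p m) (B 2) (E 1%N) = 0.
  by have [] := BE 0%N; rewrite B0 B1 E0.
have := congr1 (mulmx (dm m)) E1.
by rewrite -scalemxAr mulmx1 mulmxDr !mulmxA EE mul0mx addr0.
Qed.

End SyzygyFactor.

(** * Comparison of resolutions *)

Section ProjectiveLift.
Variables (R : comPzRingType) (Q U V : lmodType R).
Variables (f : {linear Q -> V}) (p : {linear U -> V}).

Lemma pullback_linear : linear (fun z : (Q * U)%type => f z.1 - p z.2).
Proof. by move=> r y z; rewrite /= (linearP f) (linearP p) opprD addrACA -scalerBr. Qed.

(** The pullback of p along f maps onto Q, hence has a section, even when p is
    not onto. *)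
Lemma projective_lift : projective Q -> (forall x, exists u, p u = f x) ->
  exists h : {linear Q -> U}, forall x, p (h x) = f x.
Proof.
move=> Qp fp; pose g := mklin pullback_linear.
have [|h hP] := Qp (cycles g) Q (fst \o @cycle_val _ _ _ g) idfun.
  move=> x; have [u ux] := fp x.
  have z0 : cycle_pred g (x, u) by apply/eqP; rewrite /= ux subrr.
  by exists (Cycle z0).
exists (snd \o @cycle_val _ _ _ g \o h) => x /=.
have /eqP := cycleP (h x); rewrite /= => /eqP; rewrite subr_eq0 => /eqP <-.
by congr (f _); exact: hP.
Qed.

End ProjectiveLift.

Section Comparison.
Variables (R : comPzRingType) (M : lmodType R) (P P' : resolution M).

(** Chain maps between the resolutions and a homotopy from their composite to
    the identity, constructed simultaneously by induction on the degree; only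
    what they do to boundaries is remembered. *)
Lemma comparison n : exists (a : {linear P' n -> P n}) (b : {linear P n -> P' n})
    (s : {linear P' n -> P' n.+1}),
  [/\ forall y, exists z, res_diff P n z = a (res_diff P' n y),
      forall y, exists z, res_diff P' n z = b (res_diff P n y) &
      forall y, b (a (res_diff P' n y)) =
        res_diff P' n y + res_diff P' n (s (res_diff P' n y))].
Proof.
elim: n => [|n [a [b [s [aP bP sP]]]]].
  have [a aE] := @res_projective R M P' 0%N _ _ (res_aug P) (res_aug P') (res_aug_surj P).
  have [b bE] := @res_projective R M P 0%N _ _ (res_aug P') (res_aug P) (res_aug_surj P').
  have [|s sE] := @projective_lift R _ _ _ ((b \o a) \- idfun) (res_diff P' 0%N)
      (@res_projective R M P' 0%N).
    by move=> x; apply/res_exact0; rewrite /= linearB bE aE subrr.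
  exists a, b, s; split=> y.
  - by apply/res_exact0; rewrite aE; apply/res_exact0; exists y.
  - by apply/res_exact0; rewrite bE; apply/res_exact0; exists y.
  - by rewrite sE /= addrC subrK.
have [a1 a1E] := projective_lift (f := a \o res_diff P' n) (@res_projective R M P' n.+1) aP.
have [b1 b1E] := projective_lift (f := b \o res_diff P n) (@res_projective R M P n.+1) bP.
have dd (S : resolution M) y : res_diff S n (res_diff S n.+1 y) = 0.
  by apply/res_exact; exists y.
have [|s1 s1E] := @projective_lift R _ _ _
    ((b1 \o a1) \- (idfun \+ (s \o res_diff P' n))) (res_diff P' n.+1)
    (@res_projective R M P' n.+1).
  move=> x; apply/res_exact.
  by rewrite /= linearB b1E /= a1E /= sP linearD subrr.
exists a1, b1, s1; split=> y.
- by apply/res_exact; rewrite a1E /= dd linear0.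
- by apply/res_exact; rewrite b1E /= dd linear0.
- by rewrite s1E /= dd linear0 addr0 addrC subrK.
Qed.

(** Multiplication by r on the syzygy im(S_(n+1) -> S_n) extends to the map d
    h on S_n, i.e. factors through a projective module. *)
Definition syzygy_factors r (S : resolution M) n :=
  exists h : {linear S n -> S n.+1}, forall y,
    r *: res_diff S n y = res_diff S n (h (res_diff S n y)).

Lemma syzygy_factors_transfer r n : syzygy_factors r P n -> syzygy_factors r P' n.
Proof.
move=> [h hE]; have [a [b [s [aP bP sP]]]] := comparison n.
have [b1 b1E] := projective_lift (f := b \o res_diff P n) (@res_projective R M P n.+1) bP.
exists ((b1 \o h \o a) \- (r \*: s)) => y /=.
rewrite linearB b1E /=; have [z zE] := aP y.
rewrite -zE -hE zE linearZ /= sP scalerDr linearZ /= addrK //.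
Qed.

(** Modulo boundaries r y equals h d y, and a cocycle z vanishes on
    boundaries; so r z = (z h) d is a coboundary. *)
Lemma Ext_killed r n N (x : Ext P' N n.+1) : syzygy_factors r P' n -> r *: x = 0.
Proof.
move=> [h hE]; rewrite -[x]homology_reprK; case: (homology_repr x) => z z0 {x}.
have z0' y : Hom_fun z (res_diff P' n.+1 y) = 0.
  by move/eqP: z0 => /(congr1 (fun f : Hom (P' n.+2) N => Hom_fun f y)).
rewrite -linearZ -[RHS](linear0 (@homology_class _ _ _ _ _ _)).
apply/homology_class_eq; exists (Hom_fun z \o h : {linear P' n -> N}).
apply: HomP => y; rewrite /= subr0.
have [w wE] : exists w, res_diff P' n.+1 w = r *: y - h (res_diff P' n y).
  by apply/res_exact; rewrite linearB linearZ /= hE subrr.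
have := z0' w; rewrite wE linearB linearZ /= => /eqP.
by rewrite subr_eq0 eq_sym => /eqP.
Qed.

End Comparison.

Theorem corollary4p3 (R : comPzRingType) (R_noetherian : noetherian R) :
  ann_Dsg R = ca_mod R.
Proof.
apply/seteqP; split=> r.
  move=> /ann_DsgE rN M Mfg.
  have [p [d [aug [augS ex0 ex]]]] := free_resolution R_noetherian Mfg.
  have [n0 H] := syzygy_factor (rN (exist _ _ (free_complex_Df R_noetherian ex))).
  pose S := @Resolution R M (fun n => 'rV[R]_(p n)) (fun n => mulmxr (mx (p n.+1) (p n) (d n)))
    aug (fun n => @rV_projective R (p n)) augS ex0 ex.
  exists n0.+1 => // P N _ [//|n] n0n x; apply: Ext_killed.
  apply: (@syzygy_factors_transfer R M S).
  have [Y YE] := H n n0n; exists (mulmxr Y) => y /=.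
  by rewrite scalemxAr YE !mulmxA.
move=> rca; apply/ann_DsgE => X; exact: acts_as_zero_ca_mod.
Qed.
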